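(* Assume $H(A)_1$, $H(J)_1$, $H_0$, $H(U)$, $H_{aux}$ and $H_{const}$ (all stated in the context). Then the solution to problem (P) is unique, i.e. any two solutions of (P) coincide.
   Context: **Spaces.** $0<T<\infty$. $V\subset H\subset V^*$ is an evolution triple of real spaces: $V$ is a reflexive separable Banach space, $H$ a separable Hilbert space, the embeddings are continuous, dense and compact; $i:V\to H$ is the embedding. $U$ is a reflexive Banach space. $\mathcal{V}=L^2(0,T;V)$, $\mathcal{U}=L^2(0,T;U)$, $\mathcal{W}=\{u\in\mathcal{V}:u'\in\mathcal{V}^*\}$ with the distributional derivative. $\|\cdot\|$ and $\langle\cdot,\cdot\rangle$ without subscript are the norm of $V$ and the duality between $V^*$ and $V$. $M^{2,2}(0,T;V,V^* )=L^2(0,T;V)\cap BV^2(0,T;V^* )$ with norm $\|\cdot\|_{\mathcal V}+\|\cdot\|_{BV^2(0,T;V^* )}$, where $\|x\|^2_{BV^2(0,T;V^* )}=\sup\sum_i\|x(b_i)-x(a_i)\|^2_{V^*}$, the supremum over finite partitions of $(0,T)$ into disjoint intervals $(a_i,b_i)$ whose closures cover $[0,T]$. **Clarke subdifferential.** For locally Lipschitz $J:U\to\mathbb{R}$, $J^0(x;z)=\limsup_{y\to x,\lambda\to0^+}\frac{J(y+\lambda z)-J(y)}{\lambda}$ and $\partial J(x)=\{\xi\in U^*:J^0(x;y)\ge\langle\xi,y\rangle_{U^*\times U}\ \forall y\in U\}$. **Pseudomonotonicity.** A multifunction $A:X\to2^{X^*}$ on a real reflexive Banach space is pseudomonotone if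 (i) its values are nonempty, weakly compact and convex; (ii) it is upper semicontinuous from each finite-dimensional subspace of $X$ into $X^*$ with the weak topology; (iii) if $v_n\to v$ weakly in $X$, $v_n^*\in A(v_n)$ and $\limsup\langle v_n^*,v_n-v\rangle\le0$, then for every $y\in X$ there is $u(y)\in A(v)$ with $\langle u(y),v-y\rangle\le\liminf\langle v_n^*,v_n-y\rangle$. A single-valued map is identified with the corresponding singleton-valued multifunction. **Assumptions.** - $H(A)$: $A:V\to V^*$ (i) is pseudomonotone; (ii) $\|A(v)\|_{V^*}\le a+b\|v\|$ for all $v\in V$, with $a\ge0$, $b>0$; (iii) $\langle A(v),v\rangle\ge\alpha\|v\|^2-\beta\|v\|_H^2$ for all $v\in V$, with $\alpha>0$, $\beta\ge0$. - $H(A)_1$: $H(A)$ holds and $\langle Au-Av,u-v\rangle\ge m_1\|u-v\|^2-m_2\|u-v\|_H^2$ for all $u,v\in V$, with $m_1\ge0$, $m_2>0$. - $H(J)$: $J:U\to\mathbb{R}$ (i) is locally Lipschitz; (ii) $\|\xi\|_{U^*}\le c(1+\|u\|_U)$ for all $u\in U$, $\xi\in\partial J(u)$, with $c>0$. - $H(J)_1$: $H(J)$ holds and $\langle\xi-\eta,u-v\rangle_{U^*\times U}\ge-m_3\|u-v\|_U^2$ for all $u,v\in U$, $\xi\in\partial J(u)$, $\eta\in\partial J(v)$, with $m_3>0$. - $H_0$: $f\in\mathcal{V}^*$ and $u_0\in H$. - $H(U)$: there is a linear, continuous and compact map $\iota:V\to U$ such that the Nemytskii map $\bar\iota:M^{2,2}(0,T;V,V^*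 )\to\mathcal{U}$, $(\bar\iota v)(t)=\iota(v(t))$, is also compact. - $H_{aux}$: one of the following holds: A) there is a linear continuous $p:H\to U$ with $p(i(v))=\iota(v)$ for $v\in V$; B) $\alpha>c\|\iota\|^2_{\mathcal{L}(V;U)}$; C) for every $u\in U$, $J^0(u;-u)\le d(1+\|u\|_U^\sigma)$ with $d\ge0$, $1\le\sigma<2$. - $H_{const}$: either A) of $H_{aux}$ holds or $m_1\ge m_3\|\iota\|^2_{\mathcal{L}(V;U)}$. **Problem (P).** Find $u\in\mathcal{W}$ with $u(0)=u_0$ and $u'(t)+Au(t)+\iota^*\partial J(\iota u(t))\ni f(t)$ for a.e. $t\in(0,T)$; i.e. there exists $\eta\in\mathcal{V}^*$ with $u'(t)+Au(t)+\eta(t)=f(t)$ for a.e. $t$ and $\langle\eta(t),v\rangle\in\langle\partial J(\iota u(t)),\iota v\rangle_{U^*\times U}$ for a.e. $t\in(0,T)$ and all $v\in V$. *)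

(* Defs.v *)
From HB Require Import structures.
From mathcomp Require Import all_boot all_order all_algebra.
From mathcomp Require Import all_classical all_reals all_analysis.
From mathcomp Require Import ring.

Set Implicit Arguments.
Unset Strict Implicit.
Unset Printing Implicit Defensive.

Import Order.TTheory GRing.Theory Num.Theory.
Import numFieldNormedType.Exports.

Local Open Scope classical_set_scope.
Local Open Scope ring_scope.

Section operator_norm.
Context {R : realType} {X Y : normedModType R}.

Definition op_norm (f : X -> Y) : R :=
  sup [set `|f x| | x in [set x | `|x| <= 1]].

Definition compact_map (f : X -> Y) : Prop :=
  forall B : set X, bounded_set B -> precompact (f @` B).

Lemma op_norm_has_sup (f : {linear X -> Y}) : continuous f ->
  has_sup [set `|f x| | x in [set x | `|x| <= 1]].
Proof.
move=> cf; split; first by exists `|f 0|, 0 => //=; rewrite normr0.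
have /linear_bounded_continuous/bounded_funP/(_ 1)[M fM] := cf.
by exists M => _ [x /= x1 <-]; exact: fM.
Qed.

Lemma op_norm_ler (f : {linear X -> Y}) : continuous f ->
  forall x, `|f x| <= op_norm f * `|x|.
Proof.
move=> cf x; have [->|x0] := eqVneq x 0; first by rewrite raddf0 !normr0 mulr0.
have nx : 0 < `|x| by rewrite normr_gt0.
rewrite -ler_pdivrMr//.
suff : `|f (`|x|^-1 *: x)| <= op_norm f.
  by rewrite linearZ/= normrZ ger0_norm ?invr_ge0// mulrC.
apply: sup_upper_bound; first exact: op_norm_has_sup.
by exists (`|x|^-1 *: x) => //=; rewrite normrZ ger0_norm ?invr_ge0// mulVf ?gt_eqF.
Qed.

Lemma op_norm_ge0 (f : {linear X -> Y}) : continuous f -> 0 <= op_norm f.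
Proof.
move=> cf; apply: (@le_trans _ _ `|f 0|) => //.
by apply: sup_upper_bound; [exact: op_norm_has_sup|exists 0; rewrite //= normr0].
Qed.

End operator_norm.

Section dual.
Context {R : realType} (X : normedModType R).

(* The topological dual: continuous linear functionals, normed by the operator
   norm; an element coerces to a function, so the duality is application. *)
Definition dual_pred : {pred X -> R^o} :=
  [pred f | `[< linear f /\ continuous f >]].

Record dual := Dual { dual_val :> X -> R^o; dual_valP : dual_val \in dual_pred }.

HB.instance Definition _ := [isSub for dual_val].
HB.instance Definition _ := [Choice of dual by <:].

Lemma dual_submod_closed : submod_closed dual_pred.
Proof.
split=> [|a f g].
  have E x : (0 : X -> R^o) x = 0 by [].
  apply/asboolP; split; first by move=> k x y; rewrite !E scaler0 addr0.
  exact: cst_continuous.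
move=> /asboolP[lf cf] /asboolP[lg cg]; apply/asboolP; split.
  move=> k x y; rewrite !fctE lf lg !scalerDr !scalerA (mulrC a) -!addrA.
  by congr (_ + _); rewrite addrCA.
by move=> x; apply: continuousD; [apply: continuousZr; exact: cf|exact: cg].
Qed.

HB.instance Definition _ := GRing.isSubmodClosed.Build R (X -> R^o) dual_pred
  dual_submod_closed.
HB.instance Definition _ := [SubChoice_isSubLmodule of dual by <:].

Lemma dual_linear (f : dual) : linear f.
Proof. by case/asboolP: (dual_valP f). Qed.

Lemma dual_continuous (f : dual) : continuous f.
Proof. by case/asboolP: (dual_valP f). Qed.

HB.instance Definition _ (f : dual) :=
  GRing.isLinear.Build R X R^o _ (dual_val f) (dual_linear f).


Definition dual_norm (f : dual) : R := op_norm (f : X -> R^o).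

Lemma dual_norm_triangle f g : dual_norm (f + g) <= dual_norm f + dual_norm g.
Proof.
apply: ge_sup; first exact: (op_norm_has_sup (@dual_continuous (f + g))).1.
move=> _ [x /= x1 <-]; apply: le_trans (ler_normD _ _) _.
apply: lerD; (apply: sup_upper_bound; [|by exists x]).
- exact: (op_norm_has_sup (@dual_continuous f)).
- exact: (op_norm_has_sup (@dual_continuous g)).
Qed.

Let dual_norm_scale_le (l : R) (f : dual) :
  dual_norm (l *: f) <= `|l| * dual_norm f.
Proof.
apply: ge_sup; first exact: (op_norm_has_sup (@dual_continuous (l *: f))).1.
move=> _ [x /= x1 <-]; rewrite normrM ler_wpM2l//.
apply: sup_upper_bound; last by exists x.
exact: (op_norm_has_sup (@dual_continuous f)).
Qed.

Lemma dual_norm_scale (l : R) (f : dual) : dual_norm (l *: f) = `|l| * dual_norm f.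
Proof.
apply/eqP; rewrite eq_le dual_norm_scale_le/=.
have [->|l0] := eqVneq l 0.
  by rewrite normr0 mul0r; exact: (op_norm_ge0 (@dual_continuous (0 *: f))).
have := dual_norm_scale_le l^-1 (l *: f).
by rewrite scalerA mulVf// scale1r normfV ler_pdivlMl ?normr_gt0.
Qed.

Lemma dual_norm0_eq0 (f : dual) : dual_norm f = 0 -> f = 0.
Proof.
move=> f0; apply: val_inj; apply/funext => x /=.
apply/eqP; rewrite -normr_le0.
by have := op_norm_ler (@dual_continuous f) x; rewrite -/(dual_norm f) f0 mul0r.
Qed.

HB.instance Definition _ := Lmodule_isNormed.Build R dual
  dual_norm_triangle dual_norm_scale dual_norm0_eq0.

End dual.

Section banach.
Context {R : realType} (X : normedModType R).

Definition reflexive_space : Prop :=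
  forall F : dual (dual X), exists x : X, forall f : dual X, F f = f x.

Definition separable_space : Prop :=
  exists2 D : set X, countable D & dense D.

(* The weak topology: initial for all continuous linear functionals. *)
Definition weak_space : Type :=
  initial_topology (fun (x : X) => (fun f : dual X => f x) : {ptws dual X -> R^o}).
HB.instance Definition _ := Topological.on weak_space.

Definition weak_cvg (x : nat -> X) (l : X) : Prop :=
  (x : nat -> weak_space) @ \oo --> (l : weak_space).

Definition lin_span n (e : 'I_n -> X) : set X :=
  [set \sum_(k < n) c k *: e k | c in [set: 'I_n -> R]].

End banach.

Section pseudomonotone.
Context {R : realType} {X : normedModType R}.

(* In [pm_compact] and [pm_usc] the dual carries its own weak topology; in
   [pm_usc] the finite-dimensional subspaces are the spans of finite families. *)
Record pseudomonotone (A : X -> set (dual X)) : Prop := {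
  pm_nonempty : forall v, A v !=set0;
  pm_compact : forall v, compact (A v : set (weak_space (dual X)));
  pm_convex : forall v, convex_set (A v);
  pm_usc : forall n (e : 'I_n -> X) v, lin_span e v ->
    forall O : set (weak_space (dual X)), open O -> A v `<=` O ->
    \forall w \near within (lin_span e) (nbhs v), A w `<=` O;
  pm_liminf : forall (v_ : nat -> X) (v : X) (vs_ : nat -> dual X),
    weak_cvg v_ v -> (forall n, A (v_ n) (vs_ n)) ->
    (limn_esup (fun n => (vs_ n (v_ n - v))%:E) <= 0)%E ->
    forall y, exists2 u, A v u &
      ((u (v - y))%:E <= limn_einf (fun n => (vs_ n (v_ n - y))%:E))%E }.

End pseudomonotone.

Section clarke.
Context {R : realType} {U : normedModType R}.
Implicit Types (J : U -> R^o) (x z : U).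

Definition locally_lipschitz J : Prop :=
  forall x, exists2 N, nbhs x N & [lipschitz J y | y in N].

(* Extended-real valued; finite as soon as J is locally Lipschitz. *)
Definition clarke_dd J x z : \bar R :=
  limf_esup (fun p : U * R => ((J (p.1 + p.2 *: z) - J p.1) / p.2)%:E)
            (filter_prod (nbhs x) (at_right (0 : R))).

Definition clarke_subdiff J x : set (dual U) :=
  [set xi | forall y, ((xi y)%:E <= clarke_dd J x y)%E].

End clarke.

Section bochner.
Context {R : realType}.
Local Notation mu := (@lebesgue_measure R).
Implicit Types T : R.

(* Simple functions on ]0, T[ with values in X, written as finite sums of
   indicators of Borel sets; the sets need not be disjoint. *)
Record simple_fun T (X : normedModType R) := SimpleFun {
  sf_size : nat;
  sf_set : 'I_sf_size -> set R;
  sf_val : 'I_sf_size -> X;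
  sf_measurable : forall k, measurable (sf_set k);
  sf_sub : forall k, sf_set k `<=` `]0, T[ }.

Arguments sf_size {T X}.
Arguments sf_set {T X}.
Arguments sf_val {T X}.

Definition sf_eval T X (s : simple_fun T X) (t : R) : X :=
  \sum_(k < sf_size s) \1_(sf_set s k) t *: sf_val s k.

Definition sf_integral T X (s : simple_fun T X) : X :=
  \sum_(k < sf_size s) fine (mu (sf_set s k)) *: sf_val s k.

Definition simple_approx T (X : normedModType R) (g : R -> X)
    (s : nat -> simple_fun T X) : Prop :=
  {ae mu, forall t, t \in `]0, T[ -> (fun n => sf_eval (s n) t) @ \oo --> g t}.

Definition strongly_measurable T (X : normedModType R) (g : R -> X) : Prop :=
  exists s, @simple_approx T X g s.

(* The Bochner integral over ]0, T[, as a relation. The integrands below are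
   nonnegative and a.e. equal to Borel functions, hence the library integral
   (a supremum over Borel simple functions) is their Lebesgue integral. *)
Definition is_bochner_integral T (X : normedModType R) (g : R -> X) (x : X) : Prop :=
  exists s, [/\ @simple_approx T X g s,
    (fun n => \int[mu]_(t in `]0%R, T[) (`|g t - sf_eval (s n) t|%:E))%E @ \oo --> 0%E &
    (fun n => sf_integral (s n)) @ \oo --> x].

Definition L2norm T (X : normedModType R) (g : R -> X) : \bar R :=
  ((\int[mu]_(t in `]0%R, T[) (`|g t| ^+ 2)%:E) `^ 2^-1)%E.

Definition L2 T (X : normedModType R) (g : R -> X) : Prop :=
  strongly_measurable T g /\ (L2norm T g < +oo)%E.

(* C^oo functions with compact support in ]0, T[. *)
Definition test_function T (phi : R -> R) : Prop :=
  (forall n t, derivable (derive1n n phi) t 1) /\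
  exists a b, [/\ 0 < a, b < T & forall t, phi t != 0 -> a <= t <= b].

(* g' is the distributional derivative of g: int phi' g = - int phi g'. *)
Definition is_weak_derivative T (X : normedModType R) (g g' : R -> X) : Prop :=
  forall phi, test_function T phi -> exists x : X,
    is_bochner_integral T (fun t => derive1 phi t *: g t) x /\
    is_bochner_integral T (fun t => phi t *: g' t) (- x).

(* The partitions are 0 = t_0 < ... < t_n = T, with s = [t_1; ...; t_n]. *)
Definition BV2norm T (X : normedModType R) (x : R -> X) : \bar R :=
  poweR (ereal_sup [set (\sum_(k < size s)
     `|x (nth 0 (0 :: s) k.+1) - x (nth 0 (0 :: s) k)| ^+ 2)%:E
     | s in itv_partition 0 T]) 2^-1.

End bochner.

Section evolution_triple.
Context {R : realType}.

Record inner_product (H : normedModType R) := InnerProduct {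
  ip :> H -> H -> R;
  ipC : forall x y, ip x y = ip y x;
  ip_linear : forall a x y z, ip (a *: x + y) z = a * ip x z + ip y z;
  ip_norm : forall x, ip x x = `|x| ^+ 2 }.

Context {V H : completeNormedModType R}.

Lemma ip_cauchy_schwarz (p : inner_product H) (x y : H) :
  `|p x y| <= `|x| * `|y|.
Proof.
have [->|x0] := eqVneq x 0.
  have := ip_linear p (-1) 0 0 y; rewrite scaler0 addr0 mulN1r addNr => ->.
  by rewrite !normr0 mul0r.
have nx : 0 < `|x| ^+ 2 by rewrite exprn_gt0// normr_gt0.
pose k := - (p x y / `|x| ^+ 2).
have : 0 <= p (k *: x + y) (k *: x + y) by rewrite ip_norm sqr_ge0.
rewrite ip_linear (ipC _ x) (ipC _ y) !ip_linear !ip_norm (ipC _ y x).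
have -> : k * (k * `|x| ^+ 2 + p x y) + (k * p x y + `|y| ^+ 2) =
    `|y| ^+ 2 - p x y ^+ 2 / `|x| ^+ 2.
  by rewrite /k; field; rewrite normr_eq0.
rewrite subr_ge0 ler_pdivrMr// => le_sq.
rewrite -(@ler_pXn2r _ 2) ?nnegrE ?mulr_ge0//.
by rewrite real_normK ?num_real// exprMn mulrC.
Qed.

Lemma ip_dual_pred (p : inner_product H) (i : {linear V -> H}) (h : H) :
  continuous i -> (fun v => p h (i v) : R^o) \in @dual_pred R V.
Proof.
move=> ci; apply/asboolP.
have lp : linear (fun v => p h (i v) : R^o).
  by move=> a x y; rewrite linearP !(ipC _ h) ip_linear.
split => //.
pose g : {linear V -> R^o} := HB.pack (fun v => p h (i v) : R^o)
  (GRing.isLinear.Build _ _ _ _ _ lp).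
apply: (@bounded_linear_continuous _ _ _ g); apply/bounded_funP => r.
have /linear_bounded_continuous/bounded_funP/(_ r)[M iM] := ci.
exists (`|h| * M) => x xr; apply: le_trans (ip_cauchy_schwarz _ _ _) _.
by rewrite ler_wpM2l// iM.
Qed.

(* The embedding of H into V^*, h |-> (h, i .)_H, H being identified with H^*. *)
Definition pivot (p : inner_product H) (i : {linear V -> H}) (ci : continuous i)
  (h : H) : dual V := Dual (ip_dual_pred p h ci).

(* The conditions on [et_pivot] are those on the embedding of H into V^*. *)
Record evolution_triple := EvolutionTriple {
  et_ip : inner_product H;
  et_i : {linear V -> H};
  et_i_continuous : continuous et_i;
  et_pivot := pivot et_ip et_i_continuous;
  et_V_reflexive : reflexive_space V;
  et_V_separable : separable_space V;
  et_H_separable : separable_space H;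
  et_i_injective : injective et_i;
  et_i_dense : dense (range et_i);
  et_i_compact : compact_map et_i;
  et_pivot_continuous : continuous et_pivot;
  et_pivot_injective : injective et_pivot;
  et_pivot_dense : dense (range et_pivot);
  et_pivot_compact : compact_map et_pivot }.

End evolution_triple.
Arguments evolution_triple {R} V H.

Section problem.
Context {R : realType} {V H U : completeNormedModType R}.
Local Notation mu := (@lebesgue_measure R).
Variables (T : R) (E : evolution_triple V H).
Local Notation i := (et_i E).

Definition emb (v : V) : dual V := et_pivot E (i v).

(* M^{2,2} is made of classes of L^2(0,T;V); such a class belongs to
   BV^2(0,T;V^* ) through its representatives x : [0,T] -> V^*, so that its norm
   is the infimum over those (+oo if there is none of finite variation). *)
Definition M22norm (v : R -> V) : \bar R :=
  (L2norm T v +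
   ereal_inf [set BV2norm T x | x in
     [set x : R -> dual V | {ae mu, forall t, t \in `]0%R, T[ -> x t = emb (v t)}]])%E.

(* Compactness of v |-> iota \o v: every sequence bounded in M^{2,2} has a
   subsequence whose image converges in L^2(0,T;U). *)
Definition nemytskii_compact (iota : V -> U) : Prop :=
  forall (v : nat -> R -> V) (K : R),
  (forall n, L2 T (v n) /\ (M22norm (v n) <= K%:E)%E) ->
  exists (k : nat -> nat) (w : R -> U), [/\ {homo k : m n / (m < n)%N}, L2 T w &
    (fun n => L2norm T (fun t => iota (v (k n) t) - w t)) @ \oo --> 0%E].

Record H_U (iota : {linear V -> U}) : Prop := {
  HU_continuous : continuous iota;
  HU_compact : compact_map iota;
  HU_nemytskii : nemytskii_compact iota }.

Record H_A (A : V -> dual V) (a b alpha beta : R) : Prop := {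
  HA_pseudomonotone : pseudomonotone (fun v => [set A v]);
  HA_a : 0 <= a;
  HA_b : 0 < b;
  HA_growth : forall v, `|A v| <= a + b * `|v|;
  HA_alpha : 0 < alpha;
  HA_beta : 0 <= beta;
  HA_coercive : forall v, A v v >= alpha * `|v| ^+ 2 - beta * `|i v| ^+ 2 }.

Record H_A1 (A : V -> dual V) (a b alpha beta m1 m2 : R) : Prop := {
  HA1_HA : H_A A a b alpha beta;
  HA1_m1 : 0 <= m1;
  HA1_m2 : 0 < m2;
  HA1_monotone : forall u v,
    (A u - A v) (u - v) >= m1 * `|u - v| ^+ 2 - m2 * `|i (u - v)| ^+ 2 }.

Record H_J (J : U -> R^o) (c : R) : Prop := {
  HJ_lipschitz : locally_lipschitz J;
  HJ_c : 0 < c;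
  HJ_growth : forall u xi, clarke_subdiff J u xi -> `|xi| <= c * (1 + `|u|) }.

Record H_J1 (J : U -> R^o) (c m3 : R) : Prop := {
  HJ1_HJ : H_J J c;
  HJ1_m3 : 0 < m3;
  HJ1_monotone : forall u v xi eta,
    clarke_subdiff J u xi -> clarke_subdiff J v eta ->
    (xi - eta) (u - v) >= - m3 * `|u - v| ^+ 2 }.

Definition H_aux_A (iota : V -> U) : Prop :=
  exists2 p : {linear H -> U}, continuous p & forall v, p (i v) = iota v.

Definition H_aux_C (J : U -> R^o) : Prop :=
  exists d sigma : R, [/\ 0 <= d, 1 <= sigma < 2 &
    forall u, (clarke_dd J u (- u)%R <= (d * (1 + powR `|u| sigma))%:E)%E].

Definition H_aux (J : U -> R^o) (iota : V -> U) (alpha c : R) : Prop :=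
  [\/ H_aux_A iota, alpha > c * op_norm iota ^+ 2 | H_aux_C J].

Definition H_const (iota : V -> U) (m1 m3 : R) : Prop :=
  H_aux_A iota \/ m1 >= m3 * op_norm iota ^+ 2.

(* Elements of L^2 spaces are represented by functions R -> X, only their values
   a.e. on ]0, T[ being relevant; L^2(0,T;V)^* is L^2(0,T;V^* ). *)
Record W_fun (u : R -> V) (u' : R -> dual V) : Prop := {
  W_L2 : L2 T u;
  W_deriv_L2 : L2 T u';
  W_deriv : is_weak_derivative T (fun t => emb (u t)) u' }.

(* u(0) is the value at 0 of the representative of u in C([0,T];H). *)
Definition initial_value (u : R -> V) (u0 : H) : Prop :=
  exists w : R -> H, [/\ {within `[0, T], continuous w},
    {ae mu, forall t, t \in `]0, T[ -> w t = i (u t)} & w 0 = u0].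

Definition solution (A : V -> dual V) (J : U -> R^o) (iota : V -> U)
    (f : R -> dual V) (u0 : H) (u : R -> V) : Prop :=
  exists u' eta : R -> dual V, [/\ W_fun u u', initial_value u u0, L2 T eta,
    {ae mu, forall t, t \in `]0, T[ -> u' t + A (u t) + eta t = f t} &
    {ae mu, forall t, t \in `]0, T[ -> forall v : V,
       [set xi (iota v) | xi in clarke_subdiff J (iota (u t))] (eta t v)}].

End problem.

(* Main.v *)
Require Import Defs.
From HB Require Import structures.
From mathcomp Require Import all_boot all_order all_algebra.
From mathcomp Require Import all_classical all_reals all_analysis.
From mathcomp Require Import measurable_realfun.
From mathcomp Require Import ring lra.

Set Implicit Arguments.
Unset Strict Implicit.
Unset Printing Implicit Defensive.

Import Order.TTheory GRing.Theory Num.Theory.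
Import numFieldNormedType.Exports.

Local Open Scope classical_set_scope.
Local Open Scope ring_scope.

(** Let [w] be the difference of the continuous representatives in [H] of two
    solutions [u1] and [u2]; it vanishes at time 0. Pairing the difference of
    the two inclusions with [x = u1 t - u2 t] gives, for almost every [t],
      <u1' t - u2' t, x> <= C |i x|^2        ([solutions_dissipative]):
    the monotonicity of [A] up to [m2 |i x|^2] and the relaxed monotonicity of
    the Clarke subdifferential leave the term [m3 |iota x|^2], which either
    factors through [H] or is absorbed by [m1 |x|^2]. With the energy identity
    (d/dt) |w|^2 = 2 <w', w>, Gronwall's lemma would then give [w = 0].

    The energy identity is only needed as an inequality, in an averaged form.
    For [h > 0], expanding squares gives
      |w t|^2 - |w (t - h)|^2 <= 2 (w t - w (t - h), w t)
    ([sqr_norm_diff_le]). For almost every [t] the vector [w t] comes from an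
    element [x] of [V], and the right-hand side is twice the integral of
    <w' r, x> over ]t - h, t] ([weak_derivative_increment]). Replacing [w' r]
    by [w' t] there costs at most |x| times the integral of |w' r - w' t|.
    Divided by [h] and integrated in [t], this error tends to 0 with [h]
    ([L2_backward]): up to a small error in L^2, [w'] is a simple function, and
    for simple functions this is Lebesgue's differentiation theorem together
    with dominated convergence. A form of Gronwall's lemma that tolerates such
    errors ([averaged_gronwall]) concludes.

    The increments of [w] are obtained by scalar means. A Bochner integral with
    values in the dual of [V], evaluated at [v], is the integral of the
    evaluated function ([bochner_pairing]), so [t |-> (w t, i v)] has the scalar
    weak derivative [t |-> <w' t, v>], and the fundamental lemma of the calculus
    of variations ([du_bois_reymond]) recovers its increments. The test
    functions used there are differences of translated smooth steps, built from
    exp (- 1 / x). *)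

(** * A smooth step *)

Section smooth_step.
Context {R : realType}.
Implicit Types (f g : R -> R) (x : R) (k n : nat).

(** The recursion is on the derivative, rather than on iterated derivatives, so
    that stability under products and inverses follows by induction on [n] with
    the functions generalized. *)
Fixpoint times_derivable n f : Prop :=
  if n is m.+1 then (forall x, derivable f x 1) /\ times_derivable m (derive1 f)
  else True.

Lemma times_derivableP f :
  (forall n, times_derivable n f) -> forall n x, derivable (derive1n n f) x 1.
Proof.
move=> tf n; elim: n f tf => [|n IH] f tf x; first exact: (tf 1).1.
by rewrite derive1Sn; apply: IH => m; exact: (tf m.+1).2.
Qed.

Lemma times_derivableW n f : times_derivable n.+1 f -> times_derivable n f.
Proof. by elim: n f => //= n IH f [df tf]; split=> //; exact: IH. Qed.

Lemma times_derivable_cst n c : times_derivable n (cst c).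
Proof.
elim: n c => //= n IH c; split=> [x|]; first exact: derivable_cst.
suff -> : derive1 (cst c : R -> R) = cst 0 by exact: IH.
by apply/funext => x; rewrite derive1_cst.
Qed.

Lemma times_derivableD n f g :
  times_derivable n f -> times_derivable n g -> times_derivable n (f \+ g).
Proof.
elim: n f g => //= n IH f g [df tf] [dg tg]; split=> [x|].
  exact: derivableD.
suff -> : derive1 (f \+ g) = derive1 f \+ derive1 g by exact: IH.
by apply/funext => x; rewrite /= !derive1E deriveD.
Qed.

Lemma times_derivableM n f g :
  times_derivable n f -> times_derivable n g -> times_derivable n (f \* g).
Proof.
elim: n f g => //= n IH f g tf tg; have [[df tf'] [dg tg']] := (tf, tg).
split=> [x|]; first exact: derivableM.
suff -> : derive1 (f \* g) = (f \* derive1 g) \+ (g \* derive1 f).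
  by apply: times_derivableD; apply: IH => //; exact: times_derivableW.
by apply/funext => x; rewrite /= !derive1E deriveM.
Qed.

(** The derivative of [1 / f] is a product involving [1 / f] itself, to which the
    induction hypothesis applies. *)
Lemma times_derivableV n f : (forall x, f x != 0) ->
  times_derivable n f -> times_derivable n (fun x => (f x)^-1).
Proof.
move=> f0; elim: n => //= n IH tf; have [df tf'] := tf.
split=> [x|]; first exact: derivableV.
suff -> : derive1 (fun x => (f x)^-1) =
    cst (-1) \* (((fun x => (f x)^-1) \* (fun x => (f x)^-1)) \* derive1 f).
  have := IH (times_derivableW tf) => tV.
  by repeat apply: times_derivableM => //; exact: times_derivable_cst.
apply/funext => x; rewrite /= !derive1E deriveV//.
by rewrite /GRing.scale /=; field; exact: f0.
Qed.

Lemma is_derive_affine (c d x : R) : is_derive x 1 (fun y => c * y + d) c.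
Proof.
have -> : (fun y => c * y + d) = (c *: (id : R -> R)) + cst d by [].
by apply: is_derive_eq; rewrite addr0 /GRing.scale /= mulr1.
Qed.

Lemma derive1_affine_comp f (c d x : R) : derivable f (c * x + d) 1 ->
  is_derive x 1 (fun y => f (c * y + d)) (derive1 f (c * x + d) * c).
Proof.
move=> df; have := is_derive_affine c d x; apply: (is_derive1_comp (f := f)).
by rewrite derive1E; exact/derivableP.
Qed.

Lemma times_derivable_affine n f (c d : R) :
  times_derivable n f -> times_derivable n (fun x => f (c * x + d)).
Proof.
elim: n f => //= n IH f [df tf].
have dc x := derive1_affine_comp (df (c * x + d)).
split=> [x|]; first by have [] := dc x.
suff -> : derive1 (fun x => f (c * x + d)) = (fun x => derive1 f (c * x + d)) \* cst c.
  by apply: times_derivableM (times_derivable_cst _ _); exact: IH.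
by apply/funext => x; rewrite derive1E derive_val.
Qed.

(** The family of the functions [x^-k exp (- 1 / x)], extended by 0: the
    derivative of one is a linear combination of two others, so smoothness at 0
    need not be checked for each derivative separately. *)
Definition flat k x : R := if 0 < x then x^-1 ^+ k * expR (- x^-1) else 0.

Lemma flat_ge0 k x : 0 <= flat k x.
Proof.
by rewrite /flat; case: ifP => // x0; rewrite mulr_ge0 ?expR_ge0// exprn_ge0// invr_ge0 ltW.
Qed.

Lemma flat_gt0 k x : 0 < x -> 0 < flat k x.
Proof. by move=> x0; rewrite /flat x0 mulr_gt0 ?expR_gt0// exprn_gt0// invr_gt0. Qed.

Lemma flat_le0 k x : x <= 0 -> flat k x = 0.
Proof. by rewrite /flat; case: ltP. Qed.

Lemma flatS k x : flat k.+1 x = x^-1 * flat k x.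
Proof. by rewrite /flat; case: ifP; rewrite ?mulr0// exprS mulrA. Qed.

(** With [u = 1 / x], this is [u^k <= k! exp u], one term of the exponential
    series. *)
Lemma flat_bound k x : flat k x <= k`!%:R.
Proof.
rewrite /flat; case: ifPn => // x0; rewrite expRN ler_pdivrMr ?expR_gt0//.
case: k => [|k]; first by rewrite expr0 fact0 mul1r -expR0 ler_expR invr_ge0 ltW.
rewrite mulrC -ler_pdivrMr ?ltr0n ?fact_gt0//.
have x1_ge0 : 0 <= x^-1 by rewrite invr_ge0 ltW.
by apply: le_trans (expR_ge1Dxn k x1_ge0); rewrite lerDr.
Qed.

(** Since [flat k x = x * flat k.+1 x], the bound on the next function makes this
    one vanish linearly at 0; applied once more, it gives the derivative 0 there. *)
Lemma flat_lin k x : `|flat k x| <= k.+1`!%:R * `|x|.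
Proof.
rewrite ger0_norm ?flat_ge0//; have [x0|x0] := leP x 0.
  by rewrite flat_le0// mulr_ge0.
rewrite gtr0_norm// -ler_pdivrMr// mulrC -flatS; exact: flat_bound.
Qed.

Lemma is_derive_flat_gt0 k x : 0 < x ->
  is_derive x 1 (flat k) (flat k.+2 x - k%:R * flat k.+1 x).
Proof.
move=> x0; have xn0 : x != 0 by rewrite gt_eqF.
have dV : is_derive x 1 (fun y : R => y^-1) (- x ^- 2).
  have := is_deriveV xn0 (is_derive_id x (1 : R)).
  by move/is_derive_eq; apply; rewrite /GRing.scale/= mulr1.
have dN : is_derive x 1 (fun y : R => - y^-1) (x ^- 2).
  by have := is_deriveN dV; rewrite opprK.
have dE : is_derive x 1 (fun y : R => expR (- y^-1)) (expR (- x^-1) * x ^- 2).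
  exact: (is_derive1_comp (f := expR)).
apply: (@near_eq_is_derive _ _ _
    ((fun y => y^-1) ^+ k * (fun y => expR (- y^-1)))).
  near=> y; rewrite /flat ifT//; last by near: y; exact: lt_nbhsr.
  by rewrite exprfctE.
have := is_deriveM (is_deriveX k dV) dE.
move/is_derive_eq; apply; rewrite /flat x0 exprfctE /GRing.scale/=.
by case: k => [|k]; rewrite ?mulr0n/= ?expr0 !exprS; field.
Unshelve. all: by end_near. Qed.

Lemma is_derive_flat k x :
  is_derive x 1 (flat k) (flat k.+2 x - k%:R * flat k.+1 x).
Proof.
have [/is_derive_flat_gt0//|x0|<-] := ltgtP 0 x.
  rewrite !flat_le0 ?ltW// mulr0 subr0.
  apply: (@near_eq_is_derive _ _ _ (cst 0)).
  near=> y; rewrite flat_le0// ltW//; near: y; exact: lt_nbhsl.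
rewrite !flat_le0// mulr0 subr0.
suff cv : h^-1 *: (flat k (h *: 1 + 0) - flat k 0) @[h --> 0^'] --> (0 : R).
  by apply: DeriveDef; [apply/cvg_ex; exists 0|exact/cvg_lim].
apply/cvgr0Pnorm_le => e e0; near=> h.
have h0 : h != 0 by near: h; exact: nbhs_dnbhs_neq.
rewrite (flat_le0 _ (lexx 0)) subr0 addr0 /GRing.scale/= mulr1.
have -> : h^-1 * flat k h = flat k.+1 h by rewrite flatS.
apply: le_trans (flat_lin _ _) _.
rewrite mulrC -ler_pdivlMr ?ltr0n ?fact_gt0//.
near: h; apply: dnbhs0_le.
by rewrite divr_gt0// ltr0n fact_gt0.
Unshelve. all: by end_near. Qed.

Lemma times_derivable_flat n k : times_derivable n (flat k).
Proof.
elim: n k => //= n IH k; split=> [x|]; first by have [] := is_derive_flat k x.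
have -> : derive1 (flat k) = flat k.+2 \+ (cst (- k%:R) \* flat k.+1).
  apply/funext => x; rewrite derive1E; have dx := is_derive_flat k x.
  by rewrite derive_val/= mulNr.
apply: times_derivableD => //; apply: times_derivableM => //.
exact: times_derivable_cst.
Qed.

Definition smooth_step x : R := flat 0 x / (flat 0 x + flat 0 (1 - x)).

Let denom_gt0 x : 0 < flat 0 x + flat 0 (1 - x).
Proof.
have [x0|x0] := leP x 0; last by rewrite ltr_wpDr ?flat_ge0 ?flat_gt0.
by rewrite ltr_wpDl ?flat_ge0 ?flat_gt0// subr_gt0 (le_lt_trans x0).
Qed.

Lemma smooth_step_le0 x : x <= 0 -> smooth_step x = 0.
Proof. by move=> x0; rewrite /smooth_step flat_le0// mul0r. Qed.

Lemma smooth_step_ge1 x : 1 <= x -> smooth_step x = 1.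
Proof.
move=> x1; have := denom_gt0 x; rewrite /smooth_step (@flat_le0 _ (1 - x)) ?subr_le0//.
by rewrite addr0 => d0; rewrite divff// gt_eqF.
Qed.

Lemma smooth_step_norm x : `|smooth_step x| <= 1.
Proof.
have d0 := denom_gt0 x.
rewrite ger0_norm /smooth_step; last by rewrite divr_ge0 ?flat_ge0// ltW.
by rewrite ler_pdivrMr// mul1r lerDl flat_ge0.
Qed.

Lemma times_derivable_smooth_step n : times_derivable n smooth_step.
Proof.
apply: times_derivableM; first exact: times_derivable_flat.
apply: times_derivableV => [x|]; first by rewrite gt_eqF.
apply: times_derivableD; first exact: times_derivable_flat.
have -> : (fun x => flat 0 (1 - x)) = (fun x => flat 0 (-1 * x + 1)).
  by apply/funext => x; rewrite mulN1r addrC.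
by apply: times_derivable_affine; exact: times_derivable_flat.
Qed.

End smooth_step.

(** * The fundamental lemma of the calculus of variations *)

Section real_integrals.
Context {R : realType}.
Local Notation mu := (@lebesgue_measure R).
Implicit Types (f F : R -> R) (a b c x : R).

Lemma derivable_continuous F : (forall x, derivable F x 1) -> continuous F.
Proof.
by move=> dF x; apply: differentiable_continuous; exact/derivable1_diffP/dF.
Qed.

Lemma continuous_integrable f a b (l r : bool) : continuous f ->
  mu.-integrable [set` Interval (BSide l a) (BSide r b)] (EFin \o f).
Proof.
move=> cf; have : mu.-integrable `[a, b] (EFin \o f).
  apply: continuous_compact_integrable; first exact: segment_compact.
  exact: continuous_subspaceT.
apply: integrableS => // x; rewrite /= !in_itv/= => /andP[].
by case: l; case: r => /=; do 2 ?[move=> /ltW]; move=> -> // /ltW ->.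
Qed.

Lemma Rintegral_derive1 F a b : a <= b -> (forall x, derivable F x 1) ->
  continuous (derive1 F) -> \int[mu]_(t in `]a, b]) derive1 F t = F b - F a.
Proof.
move=> ab dF cF'; have cF := derivable_continuous dF.
rewrite Rintegral_itv_obnd_cbnd; last exact: continuous_integrable.
move: ab; rewrite le_eqVlt => /predU1P[<-|ab].
  by rewrite set_itv1 Rintegral_set1 subrr.
have cF'ab : {within `[a, b], continuous (derive1 F)} by exact: continuous_subspaceT.
have dFab : derivable_oo_LRcontinuous F a b.
  split=> [x _||]; first exact: dF.
  - by apply: cvg_at_right_filter; exact: cF.
  - by apply: cvg_at_left_filter; exact: cF.
have dFF : {in `]a, b[, derive1 F =1 derive1 F} by [].
by rewrite /Rintegral (continuous_FTC2 ab cF'ab dFab dFF).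
Qed.

End real_integrals.

Section concentration.
Context {R : realType}.
Local Notation mu := (@lebesgue_measure R).
Implicit Types (p q : R -> R) (a b c t T : R) (n : nat).
Local Notation S := (@smooth_step R).

Let dS x : derivable S x 1.
Proof. exact: (times_derivable_smooth_step 1).1. Qed.

Let cS' : continuous (derive1 S).
Proof.
by apply: derivable_continuous; exact: (times_derivable_smooth_step 2).2.1.
Qed.

(** [S] is locally constant outside [0, 1], and its derivative is continuous
    on the compact interval. *)
Lemma smooth_step_derive1_bound : exists2 M, 0 < M &
  forall x, `|derive1 S x| <= M * (0 <= x <= 1)%R%:R.
Proof.
have [] := @EVT_max _ (fun x => `|derive1 S x|) 0 1 ler01.
  by apply: continuous_subspaceT => x; apply: continuous_comp; [exact: cS'|exact: norm_continuous].
move=> z _ Mz; exists (`|derive1 S z| + 1); first by rewrite ltr_wpDl.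
move=> x; rewrite derive1E; have [x0|x0] := leP 0 x; last first.
  rewrite /= mulr0 normr_le0 (@near_eq_derive _ _ _ _ (cst 0)) ?derive_cst//.
  by near=> y; rewrite smooth_step_le0// ltW//; near: y; exact: lt_nbhsl.
have [x1|x1] := leP x 1; last first.
  rewrite /= mulr0 normr_le0 (@near_eq_derive _ _ _ _ (cst (1 : R))) ?derive_cst//.
  by near=> y; rewrite smooth_step_ge1// ltW//; near: y; exact: lt_nbhsr.
rewrite mulr1 -derive1E; apply: le_trans (Mz _ _) _; last by rewrite lerDl.
by rewrite in_itv/= x0 x1.
Unshelve. all: by end_near. Qed.

Lemma near_natSinv_lt (e : R) : 0 < e -> \forall n \near \oo, n.+1%:R^-1 < e.
Proof. by move=> e0; exact: (near_infty_natSinv_lt (PosNum e0)). Qed.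

Definition step_at n c t : R := S (n.+1%:R * t + - (n.+1%:R * c)).

Lemma is_derive_step_at n c t : is_derive t 1 (step_at n c)
  (derive1 S (n.+1%:R * t + - (n.+1%:R * c)) * n.+1%:R).
Proof. exact: derive1_affine_comp. Qed.

Lemma step_at_norm n c t : `|step_at n c t| <= 1.
Proof. exact: smooth_step_norm. Qed.

Lemma step_at_le n c t : t <= c -> step_at n c t = 0.
Proof.
by move=> tc; rewrite /step_at smooth_step_le0// subr_le0 ler_pM2l.
Qed.

Lemma step_at_ge n c t : c + n.+1%:R^-1 <= t -> step_at n c t = 1.
Proof.
move=> tc; rewrite /step_at smooth_step_ge1// -mulrBr.
by rewrite -[leLHS](@mulfV _ n.+1%:R)// ler_pM2l// lerBrDl.
Qed.

Lemma step_at_cvg c t : (fun n => step_at n c t) @ \oo --> ((c < t)%R%:R : R).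
Proof.
have [tc|ct] := leP t c.
  by rewrite (_ : (fun n => _) = cst 0); [exact: cvg_cst|apply/funext => n; rewrite step_at_le].
apply: cvg_near_cst; near=> n; rewrite step_at_ge// -lerBrDl ltW//.
near: n; apply: near_natSinv_lt.
by rewrite subr_gt0.
Unshelve. all: by end_near. Qed.

Lemma step_at_derivable n c t : derivable (step_at n c) t 1.
Proof. by have [] := is_derive_step_at n c t. Qed.

Lemma derive1_step_at n c t :
  derive1 (step_at n c) t = derive1 S (n.+1%:R * t + - (n.+1%:R * c)) * n.+1%:R.
Proof. by rewrite derive1E; have d := is_derive_step_at n c t; rewrite derive_val. Qed.

Lemma continuous_derive1_step_at n c : continuous (derive1 (step_at n c)).
Proof.
move=> t; have -> : derive1 (step_at n c) =
    (fun x => derive1 S x * n.+1%:R) \o (fun t => n.+1%:R * t + - (n.+1%:R * c)).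
  by apply/funext => x; rewrite derive1_step_at.
apply: continuous_comp.
  by apply: cvgD; [apply: cvgMr; exact: cvg_id|exact: cvg_cst].
by apply: cvgMl; exact: cS'.
Qed.

Lemma step_at_derive1_bound : exists2 M, 0 < M & forall n c t,
  `|derive1 (step_at n c) t| <= M * n.+1%:R * \1_(`[c, c + n.+1%:R^-1]) t.
Proof.
have [M M0 SM] := smooth_step_derive1_bound; exists M => // n c t.
rewrite derive1_step_at normrM (@ger0_norm _ n.+1%:R)//.
rewrite [leRHS]mulrAC ler_wpM2r//; apply: le_trans (SM _) _.
rewrite ler_wpM2l ?(ltW M0)// indicE ler_nat.
case: andP => //= -[]; rewrite subr_ge0 ler_pM2l// => ct.
rewrite -mulrBr -[leRHS](@mulfV _ n.+1%:R)// ler_pM2l// lerBlDl => tc.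
by rewrite mem_set//= in_itv/= ct.
Qed.

(** The derivatives of the steps have integral 1 and live on the shrinking
    intervals [c, c + 1 / (n + 1)], where they are bounded by a multiple of
    [n + 1]: they form an approximate identity at [c]. *)
Lemma step_at_concentrates T c p : 0 < c -> c < T -> continuous p ->
  (fun n => \int[mu]_(t in `]0, T]) (derive1 (step_at n c) t * p t)) @ \oo --> p c.
Proof.
move=> c0 cT cp; have [M M0 SM] := step_at_derive1_bound.
apply/cvgrPdist_le => e e0.
have near_c : \forall n \near \oo,
    forall t, t \in `[c, c + n.+1%:R^-1] -> `|p c - p t| <= e / M.
  have /cvgrPdist_le/(_ (e / M))[|d /= d0 pd] := cp c; first by rewrite divr_gt0.
  near=> n => t; rewrite in_itv/= => /andP[ct tc]; apply: pd => /=.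
  rewrite distrC ger0_norm ?subr_ge0// ltrBlDl (le_lt_trans tc)// ltrD2l.
  by near: n; exact: near_natSinv_lt.
near=> n.
have pcn : forall t, t \in `[c, c + n.+1%:R^-1] -> `|p c - p t| <= e / M.
  by near: n; exact: near_c.
have n1 : c + n.+1%:R^-1 < T.
  by rewrite -ltrBrDl; near: n; apply: near_natSinv_lt; rewrite subr_gt0.
have cs : continuous (derive1 (step_at n c)) by exact: continuous_derive1_step_at.
have int1 : \int[mu]_(t in `]0, T]) derive1 (step_at n c) t = 1.
  rewrite (Rintegral_derive1 (ltW (lt_trans c0 cT)) (@step_at_derivable n c) cs).
  by rewrite step_at_ge ?ltW// step_at_le ?ltW// subr0.
have cM (f g : R -> R) : continuous f -> continuous g -> continuous (fun t => f t * g t).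
  by move=> cf cg x; exact: (continuousM (cf x) (cg x)).
have -> : p c = \int[mu]_(t in `]0, T]) (derive1 (step_at n c) t * p c).
  by rewrite RintegralZr ?int1 ?mul1r//; exact: continuous_integrable.
rewrite -RintegralB//; last 2 first.
- by apply: continuous_integrable; apply: cM => // x; exact: cvg_cst.
- by apply: continuous_integrable; exact: cM.
have cB : continuous (fun t => derive1 (step_at n c) t * p c - derive1 (step_at n c) t * p t).
  move=> x; apply: cvgB; last exact: (cM _ _ cs cp x).
  by apply: (cM _ (cst (p c)) cs) => y; exact: cvg_cst.
apply: le_trans (le_normr_Rintegral _ _) _ => //; first exact: continuous_integrable.
pose g t := e * n.+1%:R * \1_(`[c, c + n.+1%:R^-1]) t.
have i1 : mu.-integrable `]0, T] (EFin \o \1_(`[c, c + n.+1%:R^-1])).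
  exact: integrableS (integrable_indic_itv c (c + n.+1%:R^-1) true false).
have ig : mu.-integrable `]0, T] (EFin \o g).
  exact: (integrableZl _ (e * n.+1%:R) i1).
apply: (@le_trans _ _ (\int[mu]_(t in `]0, T]) g t)).
  apply: le_Rintegral => //.
    by apply: continuous_integrable => x; apply: cvg_norm; exact: cB.
  move=> t _; rewrite -mulrBr normrM /g.
  have := SM n c t; rewrite indicE; case: (boolP (t \in _)) => [/set_mem tc|_].
    rewrite !mulr1 => St; apply: le_trans (ler_pM _ _ St (pcn _ tc)) _ => //.
    by rewrite mulrAC mulrCA mulfV ?gt_eqF// mulr1.
  by rewrite !mulr0 normr_le0 => /eqP ->; rewrite normr0 mul0r.
rewrite RintegralZl// /Rintegral integral_indic// setIidl; last first.
  move=> t /=; rewrite !in_itv/= => /andP[ct tc].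
  by rewrite (lt_le_trans c0)//= (le_trans tc)// ltW.
suff : e * n.+1%:R * fine (mu `[c, c + n.+1%:R^-1]) <= e by [].
rewrite lebesgue_measure_itv/= lte_fin ltrDl invr_gt0 ltr0n/=.
by rewrite addrAC subrr add0r -mulrA mulfV// mulr1.
Unshelve. all: by end_near. Qed.

Lemma step_at_test T n a b : 0 < a -> a <= b -> b + n.+1%:R^-1 < T ->
  test_function T (fun t => step_at n a t - step_at n b t).
Proof.
move=> a0 ab bT; split.
  apply: times_derivableP => m.
  have -> : (fun t => step_at n a t - step_at n b t) =
      step_at n a \+ (cst (-1) \* step_at n b).
    by apply/funext => t; rewrite /= mulN1r.
  apply: times_derivableD; last apply: times_derivableM.
  - exact: times_derivable_affine (times_derivable_smooth_step _).
  - exact: times_derivable_cst.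
  - exact: times_derivable_affine (times_derivable_smooth_step _).
exists a, (b + n.+1%:R^-1); split=> // t; apply: contraNT.
rewrite negb_and -!ltNge => /orP[ta|tb].
  by rewrite !step_at_le ?subrr ?(le_trans _ ab)// ltW.
by rewrite !step_at_ge ?subrr// ?ltW// (le_lt_trans _ tb)// lerD2r.
Qed.

(** Test with the difference of a step at [a] and a step at [b]. It tends boundedly
    to the indicator of ]a, b], and its derivative concentrates at [a] with weight
    1 and at [b] with weight -1. *)
Lemma du_bois_reymond T p q : continuous p ->
  mu.-integrable `]0, T[ (EFin \o q) ->
  (forall phi, test_function T phi ->
    \int[mu]_(t in `]0, T[) (derive1 phi t * p t) =
    - \int[mu]_(t in `]0, T[) (phi t * q t)) ->
  forall a b, 0 < a -> a <= b -> b < T ->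
    p b - p a = \int[mu]_(t in `]a, b]) q t.
Proof.
move=> cp iq Hpq a b a0 ab bT.
have cM (f g : R -> R) : continuous f -> continuous g -> continuous (fun t => f t * g t).
  by move=> cf cg x; exact: (continuousM (cf x) (cg x)).
have cs n c : continuous (fun t => derive1 (step_at n c) t * p t).
  exact: (cM _ _ (@continuous_derive1_step_at n c) cp).
have lhs : (fun n => \int[mu]_(t in `]0, T[) (derive1 (fun t => step_at n a t - step_at n b t) t * p t))
    @ \oo --> p a - p b.
  have -> : (fun n => \int[mu]_(t in `]0, T[)
        (derive1 (fun t => step_at n a t - step_at n b t) t * p t)) =
      (fun n => \int[mu]_(t in `]0, T]) (derive1 (step_at n a) t * p t) -
                \int[mu]_(t in `]0, T]) (derive1 (step_at n b) t * p t)).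
    apply/funext => n.
    rewrite -!Rintegral_itv_bndo_bndc; try exact: continuous_integrable.
    rewrite -RintegralB; [|exact: measurable_itv|exact: continuous_integrable..].
    apply: eq_Rintegral => t _; rewrite -mulrBl; congr (_ * _).
    by rewrite !derive1E deriveB//; exact: step_at_derivable.
  by apply: cvgB; apply: step_at_concentrates => //;
     rewrite ?(le_lt_trans ab) ?(lt_le_trans a0).
have rhs : (fun n => \int[mu]_(t in `]0, T[) ((step_at n a t - step_at n b t) * q t))
    @ \oo --> \int[mu]_(t in `]a, b]) q t.
  have mq : measurable_fun `]0, T[ q by move/integrableP : iq => [/measurable_EFinP].
  have ms n c : measurable_fun `]0, T[ (step_at n c).
    apply: measurable_funTS; apply: continuous_measurable_fun.
    by apply: derivable_continuous => x; exact: step_at_derivable.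
  (* The difference of two steps is only known to be bounded by 2 here. *)
  have i2q : mu.-integrable `]0, T[ (EFin \o (fun t => 2 * `|q t|)).
    by have := integrableZl _ 2 (integrable_norm iq); apply; exact: measurable_itv.
  have -> : \int[mu]_(t in `]a, b]) q t =
      \int[mu]_(t in `]0, T[) (((a < t)%R%:R - (b < t)%R%:R) * q t).
    have -> : `]a, b]%classic = `]0, T[ `&` `]a, b]%classic.
      rewrite setIidr// => t /=; rewrite !in_itv/= => /andP[at_ tb].
      by rewrite (lt_trans a0)//= (le_lt_trans tb).
    rewrite Rintegral_mkcondr; apply: eq_Rintegral => t _; rewrite patchE.
    case: ifPn => [/set_mem/=|]; first rewrite in_itv/= => /andP[-> tb].
      by rewrite ltNge tb/= subr0 mul1r.
    rewrite notin_setE/= in_itv/= => /negP; rewrite negb_and -leNgt -ltNge => /orP[ta|bt].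
      by rewrite !ltNge ta (le_trans ta ab)/= subrr mul0r.
    by rewrite bt (le_lt_trans ab bt) subrr mul0r.
  have dom n t : `]0, T[%classic t ->
      (`|((step_at n a t - step_at n b t) * q t)%:E| <= (2 * `|q t|)%:E)%E.
    move=> _; rewrite lee_fin normrM ler_wpM2r//.
    by apply: le_trans (ler_normB _ _) _; apply: lerD; exact: step_at_norm.
  have pc t : `]0, T[%classic t ->
      (fun n => ((step_at n a t - step_at n b t) * q t)%:E) @ \oo -->
      (((a < t)%R%:R - (b < t)%R%:R) * q t)%:E.
    move=> _; apply: cvg_EFin; first exact: nearW.
    by apply: cvgMl; apply: cvgB; exact: step_at_cvg.
  have mn n : measurable_fun `]0, T[
      (EFin \o (fun t => (step_at n a t - step_at n b t) * q t)).
    apply/measurable_EFinP; apply: measurable_funM => //; exact: measurable_funB.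
  apply: fine_cvg; rewrite fineK.
    apply: (@dominated_cvg _ (measurableTypeR R) R mu `]0, T[%classic _
      (fun n t => ((step_at n a t - step_at n b t) * q t)%:E)
      (fun t => (((a < t)%R%:R - (b < t)%R%:R) * q t)%:E)) i2q dom => //.
  apply: integrable_fin_num => //; apply: (le_integrable _ _ _ i2q) => //.
    exact: (@emeasurable_fun_cvg _ (measurableTypeR R) R `]0, T[%classic _ _ mn pc).
  move=> t tT; rewrite /= lee_fin (@ger0_norm _ (2 * _)) ?mulr_ge0//.
  rewrite normrM ler_wpM2r//.
  by case: (a < t)%R; case: (b < t)%R; rewrite ?subrr ?subr0 ?sub0r ?normrN ?normr0 ?normr1// ler1n.
have bn : \forall n \near \oo, b + n.+1%:R^-1 < T.
  near=> n; rewrite -ltrBrDl; near: n; apply: near_natSinv_lt.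
  by rewrite subr_gt0.
have : p a - p b = - \int[mu]_(t in `]a, b]) q t.
  apply: (cvg_unique _ lhs) => //; apply: cvg_trans (cvgN rhs).
  apply: near_eq_cvg; near=> n; apply/esym/Hpq/step_at_test => //.
  by near: n.
by move=> /(congr1 -%R); rewrite opprB opprK.
Unshelve. all: by end_near. Qed.

End concentration.

(** * Simple functions and integrals of vector-valued functions *)

Section almost_everywhere.
Context {R : realType}.
Local Notation mu := (@lebesgue_measure R).
Implicit Types P Q : R -> Prop.

Lemma aeS P Q : (forall t, P t -> Q t) ->
  {ae mu, forall t, P t} -> {ae mu, forall t, Q t}.
Proof.
move=> PQ; apply: filterS => //; first exact: (ae_filter_ringOfSetsType mu).
Qed.

Lemma aeI P Q : {ae mu, forall t, P t} -> {ae mu, forall t, Q t} ->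
  {ae mu, forall t, P t /\ Q t}.
Proof.
move=> aP aQ; apply: filterI => //; first exact: (ae_filter_ringOfSetsType mu).
Qed.

End almost_everywhere.

Section nonmeasurable.
Context d (X : measurableType d) {R : realType} (mu : {measure set X -> \bar R}).
Local Open Scope ereal_scope.
Import HBNNSimple.
Implicit Types (D : set X) (f g : X -> \bar R).

(** The integral of a nonnegative function is a supremum over the simple functions
    below it, so monotonicity does not depend on measurability. This matters here
    because norms of Bochner integrands are only almost everywhere equal to Borel
    functions. *)
Lemma le_integral_nomeas D f g : (forall x, D x -> 0 <= f x) ->
  (forall x, D x -> f x <= g x) ->
  \int[mu]_(x in D) f x <= \int[mu]_(x in D) g x.
Proof.
move=> f0 fg; have g0 x : D x -> 0 <= g x by move=> Dx; rewrite (le_trans (f0 x Dx)) ?fg.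
rewrite !ge0_integralE//; apply: ereal_sup_le => _ [h /= hf <-].
exists h => //= x; apply: le_trans (hf x) _.
by rewrite !patchE; case: ifPn => // /set_mem; exact: fg.
Qed.

(** A simple function below [f] has the same integral as its restriction to the
    complement of a null set, and this restriction is below [g]. *)
Lemma ae_le_integral_nomeas D f g : measurable D -> (forall x, D x -> 0 <= f x) ->
  (forall x, D x -> 0 <= g x) ->
  {ae mu, forall x, D x -> f x <= g x} ->
  \int[mu]_(x in D) f x <= \int[mu]_(x in D) g x.
Proof.
move=> mD f0 g0 [N [mN N0 fgN]].
rewrite ge0_integralE//; apply: ge_ereal_sup => _ [h /= hf <-].
have -> : sintegral mu h = \int[mu]_(x in setT `\` N) (h x)%:E.
  rewrite -integralT_nnsfun (@ge0_negligible_integral _ _ _ _ _ N)//.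
  - by apply/measurable_EFinP.
  - by move=> x _; rewrite lee_fin.
rewrite (_ : \int[mu]_(x in D) g x = \int[mu]_x (g \_ D) x); last by rewrite integral_mkcond.
rewrite integral_mkcond; apply: le_integral_nomeas => x _.
  by rewrite patchE; case: ifP => // _; rewrite lee_fin.
have gD0 : 0 <= (g \_ D) x by rewrite patchE; case: ifPn => // /set_mem/g0.
rewrite [leLHS]patchE; case: ifPn => [/set_mem [_ Nx]|_] //.
apply: le_trans (hf x) _; rewrite !patchE; case: ifPn => // /set_mem Dx.
by apply: contrapT => fg; apply: Nx; apply: fgN => /(_ Dx).
Qed.

End nonmeasurable.

Section simple_functions.
Context {R : realType} (T : R) (X : normedModType R).
Local Notation mu := (@lebesgue_measure R).
Implicit Types (s : simple_fun T X) (B : set R) (g : R -> X).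

(** The sets of a simple function may overlap; it is constant on the cells of the
    finite partition that they generate, which are indexed by bit vectors. *)
Definition sf_code s := {ffun 'I_(sf_size s) -> bool}.

Definition sf_value s (b : sf_code s) : X := \sum_k (b k)%:R *: sf_val k.

Definition sf_cell s (b : sf_code s) : set R :=
  \bigcap_(k in [set: 'I_(sf_size s)]) (if b k then sf_set k else ~` sf_set k).

Lemma sf_cell_measurable s (b : sf_code s) : measurable (sf_cell b).
Proof.
apply: fin_bigcap_measurable => [|k _]; first exact: finite_finset.
by case: (b k); [|apply: measurableC]; exact: sf_measurable.
Qed.

Lemma sf_cell_cover s t : exists b : sf_code s, sf_cell b t.
Proof.
exists [ffun k => t \in sf_set k] => k _; rewrite ffunE.
by case: ifPn => [/set_mem//|]; rewrite notin_setE.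
Qed.

Lemma sf_evalE s (b : sf_code s) t : sf_cell b t -> sf_eval s t = sf_value b.
Proof.
move=> tb; apply: eq_bigr => k _; rewrite indicE.
have := tb k Logic.I; case: (b k) => [/mem_set ->//|/= tk].
by rewrite memNset.
Qed.

(** Any property of the value cuts out a finite union of cells. *)
Lemma sf_eval_measurable s (P : set X) : measurable [set t | P (sf_eval s t)].
Proof.
rewrite (_ : [set t | _] = \bigcup_(b in [set b : sf_code s | P (sf_value b)]) sf_cell b).
  apply: fin_bigcup_measurable => [|b _]; first exact: finite_finset.
  exact: sf_cell_measurable.
apply/seteqP; split=> t /=; last by move=> [b Pb /sf_evalE ->].
by have [b tb] := sf_cell_cover s t; rewrite (sf_evalE tb) => Pb; exists b.
Qed.

Lemma sf_eval2_measurable s s' (P : X -> X -> Prop) :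
  measurable [set z : R * R | P (sf_eval s z.1) (sf_eval s' z.2)].
Proof.
rewrite (_ : [set z | _] = \bigcup_(b in [set: sf_code s'])
    ([set t | P (sf_eval s t) (sf_value b)] `*` sf_cell b)).
  apply: fin_bigcup_measurable => [|b _]; first exact: finite_finset.
  apply: measurableX; last exact: sf_cell_measurable.
  exact: (sf_eval_measurable s (fun x => P x (sf_value b))).
apply/seteqP; split=> -[r t] /=; last by move=> [b _ [/= Pb /sf_evalE ->]].
by have [b tb] := sf_cell_cover s' t; rewrite (sf_evalE tb) => Pb; exists b.
Qed.

Lemma sf_eval2_measurable_fun s s' (N : X -> X -> R) :
  measurable_fun setT (fun z : R * R => N (sf_eval s z.1) (sf_eval s' z.2)).
Proof.
move=> _ Y mY; rewrite setTI.
exact: (sf_eval2_measurable s s' (fun x y => Y (N x y))).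
Qed.

Lemma sf_eval_measurable_fun s (N : X -> R) : measurable_fun setT (N \o sf_eval s).
Proof.
move=> _ Y mY; rewrite setTI.
exact: (sf_eval_measurable s (fun x => Y (N x))).
Qed.

Definition sf_restrict s B (mB : measurable B) : simple_fun T X :=
  @SimpleFun _ T X (sf_size s) (fun k => sf_set k `&` B) (fun k => sf_val k)
   (fun k => measurableI _ _ (sf_measurable k) mB)
   (fun k t tB => sf_sub tB.1).

Lemma sf_restrictE s B (mB : measurable B) t :
  sf_eval (sf_restrict s mB) t = if t \in B then sf_eval s t else 0.
Proof.
rewrite /sf_eval /=; case: ifPn => tB.
  by apply: eq_bigr => k _; rewrite !indicE in_setI tB andbT.
by rewrite big1// => k _; rewrite indicE in_setI (negbTE tB) andbF scale0r.
Qed.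

Lemma sf_eval_out s t : ~ `]0, T[%classic t -> sf_eval s t = 0.
Proof.
move=> tT; apply: big1 => k _; rewrite indicE memNset ?scale0r// => /sf_sub.
exact: tT.
Qed.

(** Convergence holds everywhere, not just almost everywhere: real functions of
    the limit are then Borel measurable without completing the measure. *)
Definition sf_limit (s : nat -> simple_fun T X) g :=
  forall t, (fun n => sf_eval (s n) t) @ \oo --> g t.

(** Restrict the simple functions to the complement of a Borel null set containing
    the points where they fail to converge. *)
Lemma strongly_measurable_version g : strongly_measurable T g ->
  exists (s : nat -> simple_fun T X) g0, sf_limit s g0 /\
    {ae mu, forall t, t \in `]0, T[ -> g0 t = g t}.
Proof.
move=> [s [N [mN N0 sN]]].
exists (fun n => sf_restrict (s n) (measurableC mN)).
exists (fun t => if (t \in ~` N) && (t \in `]0, T[) then g t else 0); split=> [t|].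
  under eq_fun do rewrite sf_restrictE.
  have [tN/=|_] := boolP (t \in ~` N); last exact: cvg_cst.
  have [tT|tT] := boolP (t \in `]0, T[).
    apply: contrapT => gt; move/set_mem: tN; apply; apply: sN => /=.
    by move=> /(_ tT).
  by under eq_fun do rewrite (sf_eval_out _ (negP tT)); exact: cvg_cst.
exists N; split=> // t /=; apply: contra_notP => tN tT.
by rewrite mem_set// tT.
Qed.

Lemma sf_limit_measurable (s : nat -> simple_fun T X) g (N : X -> R) :
  sf_limit s g -> continuous N -> measurable_fun setT (N \o g).
Proof.
move=> sg cN; apply: (@measurable_fun_cvg _ _ _ _ (fun n => N \o sf_eval (s n))).
  by move=> n; exact: sf_eval_measurable_fun.
by move=> t _; apply: continuous_cvg (sg t); exact: cN.
Qed.

End simple_functions.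

Section L2_functions.
Context {R : realType} (T : R) (X : normedModType R).
Local Notation mu := (@lebesgue_measure R).
Implicit Types (s : nat -> simple_fun T X) (g : R -> X).

Definition sqr_integrable g :=
  (\int[mu]_(t in `]0%R, T[) (`|g t| ^+ 2)%:E < +oo)%E.

Lemma L2_version g : L2 T g ->
  exists s g0, [/\ sf_limit s g0, sqr_integrable g0 &
    {ae mu, forall t, t \in `]0, T[ -> g0 t = g t}].
Proof.
move=> [/strongly_measurable_version[s [g0 [sg0 g0g]]] g2]; exists s, g0; split=> //.
apply: (@le_lt_trans _ _ (\int[mu]_(t in `]0%R, T[) (`|g t| ^+ 2)%:E)%E).
  apply: ae_le_integral_nomeas => //; try by move=> t _; rewrite lee_fin.
  by apply: aeS g0g => t g0g /= /g0g ->.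
rewrite ltNge leye_eq; apply/negP => /eqP g2y; move: g2.
by rewrite /L2norm g2y poweRyr// invr_eq0.
Qed.

Lemma sf_limit_out s g t : sf_limit s g -> ~ `]0, T[%classic t -> g t = 0.
Proof.
move=> sg tT; apply: (cvg_unique (@norm_hausdorff _ X) (sg t)).
rewrite (_ : (fun n => sf_eval (s n) t) = cst 0); first exact: cvg_cst.
by apply/funext => n; exact: sf_eval_out.
Qed.

Lemma sf_limit_norm_measurable s g x : sf_limit s g ->
  measurable_fun setT (fun t => `|g t - x|).
Proof.
move=> sg; apply: (sf_limit_measurable (N := fun y => `|y - x|) sg).
by move=> y; apply: cvg_norm; apply: cvgB; [exact: cvg_id|exact: cvg_cst].
Qed.

Lemma sf_dist_measurable s g (s' : simple_fun T X) : sf_limit s g ->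
  measurable_fun setT (fun t => `|g t - sf_eval s' t|).
Proof.
move=> sg; apply: (@measurable_fun_cvg _ _ _ _
   (fun n t => `|sf_eval (s n) t - sf_eval s' t|)) => [n|t _]; last first.
  by apply: cvg_norm; apply: cvgB; [exact: sg|exact: cvg_cst].
have mp : measurable_fun setT (fun t : R => (t, t)) by exact: measurable_fun_pair.
exact: measurableT_comp (sf_eval2_measurable_fun (s n) s' (fun x y => `|x - y|)) mp.
Qed.

(** Cut the approximating functions off where they exceed [2 |g|]; the errors are
    then dominated by [3 |g|], and they still tend to 0 at every point. *)
Lemma sf_dense s g : sf_limit s g -> sqr_integrable g ->
  forall e : R, 0 < e -> exists s' : simple_fun T X,
  (\int[mu]_(t in `]0%R, T[) (`|g t - sf_eval s' t| ^+ 2)%:E < e%:E)%E.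
Proof.
move=> sg g2 e e0.
have mg : measurable_fun setT (fun t => `|g t|).
  by apply: eq_measurable_fun (sf_limit_norm_measurable 0 sg) => t _; rewrite subr0.
have ms n : measurable_fun setT (fun t => `|sf_eval (s n) t|).
  exact: (sf_eval_measurable_fun (s n) Num.norm).
pose B n := [set t | `|sf_eval (s n) t| <= 2 * `|g t|].
have mB n : measurable (B n).
  rewrite (_ : B n = setT `&` [set t | `|sf_eval (s n) t| <= 2 * `|g t|]); last by rewrite setTI.
  by apply: measurable_fun_le => //; exact: measurable_funM.
pose r n := sf_restrict (s n) (mB n).
have rg t : (fun n => sf_eval (r n) t) @ \oo --> g t.
  have [gt0|gt0] := eqVneq (g t) 0.
    rewrite gt0 (_ : (fun n => _) = cst 0); first exact: cvg_cst.
    apply/funext => n; rewrite sf_restrictE; case: ifPn => // /set_mem.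
    by rewrite /B/= gt0 normr0 mulr0 normr_le0 => /eqP.
  apply: cvg_trans (sg t); apply: near_eq_cvg; near=> n.
  rewrite sf_restrictE mem_set// /B/=.
  have -> : sf_eval (s n) t = g t - (g t - sf_eval (s n) t) by rewrite subKr.
  apply: le_trans (ler_normB _ _) _; rewrite mulrDl mul1r lerD2l.
  near: n; have /cvgrPdist_le/(_ `|g t|) := sg t.
  by apply; rewrite normr_gt0.
have r_le n t : `|g t - sf_eval (r n) t| <= 3 * `|g t|.
  apply: le_trans (ler_normB _ _) _.
  rewrite (_ : 3 = 1 + 2)// mulrDl mul1r lerD2l sf_restrictE.
  by case: ifPn => [/set_mem//|_]; rewrite normr0 mulr_ge0.
have mr n : measurable_fun setT (fun t => `|g t - sf_eval (r n) t|) by exact: sf_dist_measurable.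
have : (\int[mu]_(t in `]0%R, T[) (`|g t - sf_eval (r n) t| ^+ 2)%:E)%E @[n --> \oo] -->
       (\int[mu]_(t in `]0%R, T[) (cst 0 t))%E.
  apply: (@dominated_cvg _ (measurableTypeR R) R mu `]0, T[%classic _
     (fun n t => (`|g t - sf_eval (r n) t| ^+ 2)%:E) _ (fun t => (9 * `|g t| ^+ 2)%:E)) => //.
  - move=> n; apply/measurable_EFinP; apply: measurable_funTS.
    exact: measurable_funX (mr n).
  - move=> t _.
    have c0 : `|g t - sf_eval (r n) t| @[n --> \oo] --> (0 : R).
      rewrite -(@normr0 _ X) -(subrr (g t)).
      by apply: cvg_norm; apply: cvgB; [exact: cvg_cst|exact: rg].
    apply: cvg_EFin; first exact: nearW.
    by have c00 := cvgM c0 c0; rewrite mulr0 in c00; exact: c00.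
  - suff : mu.-integrable `]0, T[ (EFin \o (fun t => `|g t| ^+ 2)).
      by have := @integrableZl _ (measurableTypeR R) R mu `]0, T[%classic; apply.
    apply/integrableP; split.
      by apply/measurable_EFinP; apply: measurable_funTS; exact: measurable_funX mg.
    apply: le_lt_trans g2; apply: le_integral_nomeas => // t _.
    by rewrite /= ger0_norm.
  - move=> n t _; rewrite lee_fin normrX normr_id.
    rewrite (_ : 9 = 3 ^+ 2)// -?exprMn; last by rewrite expr2; ring.
    by rewrite lerXn2r ?nnegrE ?mulr_ge0.
rewrite integral0 => cv0.
have : \forall n \near \oo,
    (\int[mu]_(t in `]0%R, T[) (`|g t - sf_eval (r n) t| ^+ 2)%:E < e%:E)%E.
  apply: (cv0 [set y | (y < e%:E)%E]).
  apply: open_nbhs_nbhs; split; first exact: open_ereal_lt_ereal.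
  by rewrite /= lte_fin.
by move=> [n _ /(_ n (leqnn n)) ?]; exists (r n).
Unshelve. all: by end_near. Qed.

End L2_functions.

Section bochner_pairing.
Context {R : realType} (T : R) (X : normedModType R).
Local Notation mu := (@lebesgue_measure R).
Implicit Types (s : simple_fun T (dual X)) (v : X) (k : R -> dual X).

Lemma dual_ler (f : dual X) v : `|f v| <= `|f| * `|v|.
Proof. exact: op_norm_ler (@dual_continuous _ _ f) v. Qed.

Lemma dual_eval_continuous v : continuous (fun f : dual X => f v : R^o).
Proof.
have lev : linear (fun f : dual X => f v : R^o) by [].
pose ev : {linear dual X -> R^o} := HB.pack (fun f : dual X => f v : R^o)
  (GRing.isLinear.Build _ _ _ _ _ lev).
apply: (@bounded_linear_continuous _ _ _ ev); apply/bounded_funP => r.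
exists (r * `|v|) => f fr; apply: le_trans (dual_ler f v) _.
by rewrite ler_wpM2r.
Qed.

Lemma sf_eval_dual s t v :
  sf_eval s t v = \sum_(j < sf_size s) sf_val j v * \1_(sf_set j) t.
Proof.
rewrite /sf_eval (big_morph (fun f : dual X => f v : R) (id1 := 0) (op1 := +%R))//.
by apply: eq_bigr => j _; rewrite mulrC.
Qed.

Lemma sf_integral_dual s v :
  sf_integral s v = \sum_(j < sf_size s) sf_val j v * fine (mu (sf_set j)).
Proof.
rewrite /sf_integral (big_morph (fun f : dual X => f v : R) (id1 := 0) (op1 := +%R))//.
by apply: eq_bigr => j _; rewrite mulrC.
Qed.

Lemma sf_set_finite s (j : 'I_(sf_size s)) : (mu (sf_set j : set R) < +oo)%E.
Proof.
apply: (@le_lt_trans _ _ (mu `]0, T[)).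
  by apply: le_measure; rewrite ?inE//; [exact: sf_measurable|exact: sf_sub].
rewrite lebesgue_measure_itv/=; case: ifP => _; last exact: ltry.
by rewrite -EFinB ltry.
Qed.

Lemma integrable_sf_set s (j : 'I_(sf_size s)) :
  mu.-integrable `]0, T[ (EFin \o \1_(sf_set j)).
Proof.
apply/integrableP; split.
  apply/measurable_EFinP; apply: measurable_funTS.
  exact: measurable_indic (sf_measurable j).
rewrite (_ : (\int[mu]_(t in _) _)%E = (\int[mu]_(t in `]0%R, T[) (\1_(sf_set j) t)%:E)%E).
  rewrite integral_indic//; last exact: sf_measurable.
  by apply: le_lt_trans (sf_set_finite j); rewrite setIidl//; exact: sf_sub.
by apply: eq_integral => t _; rewrite /= ger0_norm// indicE ler0n.
Qed.

Lemma integrable_sf_term s (j : 'I_(sf_size s)) (c : R) :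
  mu.-integrable `]0, T[ (EFin \o (fun t => c * \1_(sf_set j) t)).
Proof. by have := integrableZl _ c (integrable_sf_set j); apply. Qed.

Lemma integrable_sf_dual s v : mu.-integrable `]0, T[ (EFin \o (fun t => sf_eval s t v)).
Proof.
rewrite (_ : EFin \o _ = fun t => (\sum_(j < sf_size s) (sf_val j v * \1_(sf_set j) t)%:E)%E).
  by apply: integrable_sum => // j _; exact: integrable_sf_term.
by apply/funext => t; rewrite /= sf_eval_dual sumEFin.
Qed.

Lemma Rintegral_sf_dual s v :
  \int[mu]_(t in `]0, T[) (sf_eval s t v) = sf_integral s v.
Proof.
rewrite sf_integral_dual /Rintegral.
under eq_integral do rewrite sf_eval_dual -sumEFin.
rewrite integral_sum//; last by move=> j; exact: integrable_sf_term.
rewrite (eq_bigr (fun j : 'I_(sf_size s) => ((sf_val j : dual X) v * fine (mu (sf_set j)))%:E)); last first.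
  move=> j _; under eq_integral do rewrite EFinM.
  rewrite integralZl//; last exact: integrable_sf_set.
  rewrite integral_indic//; last exact: sf_measurable.
  rewrite setIidl; last exact: sf_sub.
  by rewrite EFinM fineK// ge0_fin_numE// sf_set_finite.
by rewrite sumEFin.
Qed.

(** The identity holds for simple functions, and both sides are continuous along
    an approximating sequence because [|k v| <= |k| |v|]. *)
Lemma bochner_pairing k x v (kappa : R -> R) : is_bochner_integral T k x ->
  mu.-integrable `]0, T[ (EFin \o kappa) ->
  {ae mu, forall t, t \in `]0, T[ -> kappa t = k t v} ->
  \int[mu]_(t in `]0, T[) kappa t = x v.
Proof.
move=> [s [_ sk sx]] ik kE.
(* [|v|] may be 0, and is replaced by [|v| + 1] to be divided by. *)
have c0 : 0 < `|v| + 1 by rewrite ltr_wpDl.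
have iB n : mu.-integrable `]0, T[ (EFin \o (fun t => kappa t - sf_eval (s n) t v)).
  by have := integrableB _ ik (integrable_sf_dual (s n) v); apply.
have bnd n : ((`|\int[mu]_(t in `]0, T[) kappa t - sf_integral (s n) v|)%:E <=
    (`|v| + 1)%:E * \int[mu]_(t in `]0%R, T[) (`|k t - sf_eval (s n) t|%:E))%E.
  rewrite -Rintegral_sf_dual -RintegralB//; last exact: integrable_sf_dual.
  rewrite EFin_normr_Rintegral//.
  apply: le_trans (le_abse_integral _ _ _) _ => //.
    by case/integrableP: (iB n).
  rewrite -lee_pdivrMl//.
  have c1 : (0 <= ((`|v| + 1)^-1)%:E)%E by rewrite lee_fin invr_ge0 ltW.
  have mB : measurable_fun `]0, T[
      (fun t => `|(kappa t - sf_eval (s n) t v)%:E|%E).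
    by apply: measurableT_comp => //; case/integrableP: (iB n).
  rewrite -ge0_integralZl//.
  apply: ae_le_integral_nomeas => [//|t _|t _|]; rewrite ?lee_fin ?mule_ge0//.
  move: kE; apply: aeS => t kE tT; rewrite /= -EFinM lee_fin kE//.
  rewrite ler_pdivrMl//; apply: le_trans (dual_ler (k t - sf_eval (s n) t) v) _.
  by rewrite mulrC ler_wpM2r// lerDl.
apply: (cvg_unique _ (F := (fun n => sf_integral (s n) v) @ \oo)) => //; last first.
  exact: (continuous_cvg _ (@dual_eval_continuous v x) sx).
apply/cvgrPdist_le => e e0.
have : \forall n \near \oo,
    (\int[mu]_(t in `]0%R, T[) (`|k t - sf_eval (s n) t|%:E) < (e / (`|v| + 1))%:E)%E.
  apply: (sk [set y | (y < (e / (`|v| + 1))%:E)%E]).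
  apply: open_nbhs_nbhs; split; first exact: open_ereal_lt_ereal.
  by rewrite /= lte_fin divr_gt0.
apply: filterS => n /ltW sn; rewrite -lee_fin; apply: le_trans (bnd n) _.
by rewrite -lee_pdivlMl// -EFinM mulrC.
Qed.

End bochner_pairing.

(** * Backward averages *)

Section backward_average.
Context {R : realType}.
Local Notation mu := (@lebesgue_measure R).
Implicit Types (F G : R -> R -> R) (a b : R -> R) (n : nat) (t r : R).

(** The average of [F t] over the window of length [1 / (n + 1)] ending at [t].
    The integrand may depend on the end point: it will be an oscillation such as
    [|g r - g t|]. *)
Definition bavg n F t : \bar R :=
  (n.+1%:R%:E * \int[mu]_(r in `](t - n.+1%:R^-1)%R, t]) (F t r)%:E)%E.

Definition jointly_measurable F := measurable_fun setT (fun z : R * R => F z.1 z.2).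

Lemma jointly_measurable_slice F t : jointly_measurable F -> measurable_fun setT (F t).
Proof. by move=> mF; exact: (measurable_fun_pair2 t mF). Qed.

Let K n : set (R * R) := [set z | z.1 - n.+1%:R^-1 < z.2 <= z.1].

Let mK n : measurable (K n).
Proof.
rewrite (_ : K n = (setT `&` [set z : R * R | z.1 - n.+1%:R^-1 < z.2]) `&`
                   (setT `&` [set z : R * R | z.2 <= z.1])).
  apply: measurableI; last exact: measurable_fun_le.
  rewrite -[X in measurable X]setCK; apply: measurableC.
  rewrite (_ : ~` _ = setT `&` [set z : R * R | z.2 <= z.1 - n.+1%:R^-1]).
    by apply: measurable_fun_le => //; exact: measurable_funB.
  apply/seteqP; split=> z /=.
    by move=> zz; split=> //; rewrite leNgt; apply/negP => z2; exact: zz.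
  by move=> [_ zz] [_]; rewrite ltNge zz.
by apply/seteqP; split=> z /=; [move=> /andP[? ?]|move=> [[_ ?] [_ ?]]; apply/andP].
Qed.

Let bavgE n F t : bavg n F t =
  (n.+1%:R%:E * \int[mu]_r (F t r * \1_(K n) (t, r))%:E)%E.
Proof.
rewrite /bavg integral_mkcond; congr (_ * _)%E; apply: eq_integral => r _.
rewrite patchE indicE /K.
have -> : (r \in `](t - n.+1%:R^-1), t]%classic) =
    ((t, r) \in [set z : R * R | z.1 - n.+1%:R^-1 < z.2 <= z.1]).
  by apply/idP/idP => /set_mem H; apply/mem_set; rewrite /= ?in_itv in H *.
by case: ifP; rewrite ?mulr1 ?mulr0.
Qed.

Let mFK n F : jointly_measurable F ->
  measurable_fun setT (fun z : R * R => (F z.1 z.2 * \1_(K n) (z.1, z.2))%:E).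
Proof.
move=> mF; apply/measurable_EFinP; apply: measurable_funM => //.
rewrite (_ : (fun z => _) = \1_(K n)); last by apply/funext => -[].
exact: measurable_indic.
Qed.

Lemma bavg_ge0 n F t : (forall r, 0 <= F t r) -> (0 <= bavg n F t)%E.
Proof.
by move=> F0; rewrite mule_ge0// integral_ge0// => r _; rewrite lee_fin.
Qed.

Lemma bavg_measurable n F : (forall t r, 0 <= F t r) -> jointly_measurable F ->
  measurable_fun setT (bavg n F).
Proof.
move=> F0 mF; rewrite (_ : bavg n F = fun t => (n.+1%:R%:E *
   fubini_F mu (fun z : R * R => (F z.1 z.2 * \1_(K n) (z.1, z.2))%:E) t)%E).
  apply: emeasurable_funM => //; apply: measurable_fun_fubini_tonelli_F.
    exact: mFK.
  by move=> z; rewrite lee_fin mulr_ge0.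
by apply/funext => t; rewrite bavgE.
Qed.

Lemma bavg_le n F G t : (forall r, 0 <= F t r) -> (forall r, F t r <= G t r) ->
  (bavg n F t <= bavg n G t)%E.
Proof.
move=> F0 FG; apply: lee_wpmul2l => //.
by apply: le_integral_nomeas => r _; rewrite lee_fin.
Qed.

Lemma bavgD n F G t : (forall r, 0 <= F t r) -> (forall r, 0 <= G t r) ->
  measurable_fun setT (F t) -> measurable_fun setT (G t) ->
  bavg n (fun t r => F t r + G t r) t = (bavg n F t + bavg n G t)%E.
Proof.
move=> F0 G0 mF mG; rewrite /bavg; under eq_integral do rewrite EFinD.
rewrite ge0_integralD//; try by move=> r _; rewrite lee_fin.
- by rewrite ge0_muleDr// integral_ge0// => r _; rewrite lee_fin.
- by apply/measurable_EFinP; exact: measurable_funTS.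
- by apply/measurable_EFinP; exact: measurable_funTS.
Qed.

Lemma bavgZ n F t c : 0 <= c -> (forall r, 0 <= F t r) ->
  measurable_fun setT (F t) ->
  bavg n (fun t r => c * F t r) t = (c%:E * bavg n F t)%E.
Proof.
move=> c0 F0 mF; rewrite /bavg; under eq_integral do rewrite EFinM.
rewrite ge0_integralZl//.
- by rewrite muleCA.
- by apply/measurable_EFinP; exact: measurable_funTS.
- by move=> r _; rewrite lee_fin.
Qed.

Lemma mu_itv_oc (t : R) n : mu `](t - n.+1%:R^-1), t] = (n.+1%:R^-1)%:E.
Proof.
rewrite lebesgue_measure_itv/= lte_fin ltrBlDr ltrDl invr_gt0 ltr0n/=.
by rewrite -EFinB opprB addrC subrK.
Qed.

Lemma bavg_cst n b t : bavg n (fun t _ => b t) t = (b t)%:E.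
Proof.
rewrite /bavg integral_cst//.
by rewrite [X in (_ * (_ * X))%E]mu_itv_oc -!EFinM mulrCA mulfV// mulr1.
Qed.

(** By Tonelli's theorem: each [r] lies in the windows ending in
    [r, r + 1 / (n + 1)[, which have total weight 1. *)
Lemma integral_bavg n a : (forall r, 0 <= a r) -> measurable_fun setT a ->
  (\int[mu]_t bavg n (fun _ r => a r) t = \int[mu]_r (a r)%:E)%E.
Proof.
move=> a0 ma.
have ja : jointly_measurable (fun _ r => a r) by exact: measurableT_comp.
under eq_integral do rewrite bavgE.
have jm := mFK n ja.
have k0 (z : R * R) : (0 <= (a z.2 * \1_(K n) (z.1, z.2))%:E)%E.
  by rewrite lee_fin mulr_ge0.
rewrite ge0_integralZl//; last 2 first.
- exact: (@measurable_fun_fubini_tonelli_F _ _ (measurableTypeR R) (measurableTypeR R) R mu _ jm k0).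
- by move=> t _; apply: integral_ge0 => r _; exact: (k0 (t, r)).
rewrite (@fubini_tonelli _ _ (measurableTypeR R) (measurableTypeR R) R mu mu _ jm k0).
rewrite -ge0_integralZl//; last 2 first.
- exact: (@measurable_fun_fubini_tonelli_G _ _ (measurableTypeR R) (measurableTypeR R) R mu _ jm k0).
- by move=> r _; apply: integral_ge0 => t _; exact: (k0 (t, r)).
apply: eq_integral => r _ /=.
rewrite (_ : (\int[mu]_x _)%E = (a r * n.+1%:R^-1)%:E).
  by rewrite -EFinM mulrCA mulfV// mulr1.
transitivity (\int[mu]_t ((a r)%:E * (\1_(`[r, (r + n.+1%:R^-1)%R[) t)%:E)%E)%E.
  apply: eq_integral => t _; rewrite -EFinM; rewrite !indicE; congr (_ * (nat_of_bool _)%:R)%:E.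
  apply/idP/idP => /set_mem H; apply/mem_set; move: H; rewrite /K/= in_itv/=.
    by move=> /andP[tr ->]/=; rewrite -ltrBlDr.
  by move=> /andP[-> tr]; rewrite ltrBlDr tr.
rewrite ge0_integralZl//; [|by apply/measurable_EFinP; exact: measurable_indic|by rewrite lee_fin].
rewrite integral_indic// setIT [X in (_ * X)%E](_ : _ = (n.+1%:R^-1)%:E)//.
apply: eq_trans (lebesgue_measure_itv `[r, r + n.+1%:R^-1[) _.
by rewrite /= lte_fin ltrDl invr_gt0 ltr0n/= -EFinB addrAC subrr add0r.
Qed.

End backward_average.

(** * Backward oscillations of square integrable functions *)

Section simple_density.
Context {R : realType} (T : R) (X : normedModType R).
Local Notation mu := (@lebesgue_measure R).
Implicit Types (s : simple_fun T X) (n : nat) (t r : R).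

Lemma sf_bounded s : exists2 C, 0 < C & forall t, `|sf_eval s t| <= C.
Proof.
exists (1 + \sum_(k < sf_size s) `|sf_val k|); first by rewrite ltr_pwDl// sumr_ge0.
move=> t; apply: le_trans (ler_norm_sum _ _ _) _; apply: ler_wpDl => //.
apply: ler_sum => k _; rewrite normrZ indicE -[leRHS]mul1r ler_wpM2r//.
by case: (t \in _); rewrite ?normr1 ?normr0.
Qed.

Lemma sf_dist_lebesgue_pt s (x : X) :
  {ae mu, forall t, lebesgue_pt (fun r => `|sf_eval s r - x|) t}.
Proof.
apply: lebesgue_differentiation; split.
- exact: (sf_eval_measurable_fun s (fun y => `|y - x|)).
- exact: openT.
- move=> K _ cK; have [C C0 sC] := sf_bounded s.
  apply: (@le_lt_trans _ _ (\int[mu]_(t in K) (C + `|x|)%:E)%E).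
    apply: le_integral_nomeas => // t _; rewrite lee_fin normr_id.
    by apply: le_trans (ler_normB _ _) _; rewrite lerD2r.
  rewrite integral_cst//; last exact: compact_measurable.
  by rewrite lte_mul_pinfty ?lee_fin ?addr_ge0 ?(ltW C0)//; exact: compact_finite_measure.
Qed.

(** A simple function has finitely many values, so a statement true almost
    everywhere for each fixed vector is true almost everywhere with the vector
    replaced by the value at the current point. *)
Lemma ae_sf_value s (P : X -> R -> Prop) :
  (forall x, {ae mu, forall t, P x t}) -> {ae mu, forall t, P (sf_eval s t) t}.
Proof.
move=> aP.
have : {ae mu, forall t, forall b, b \in enum {: sf_code s} -> P (sf_value b) t}.
  elim: (enum _) => [|b l IH]; first by apply: aeW => t b; rewrite in_nil.
  move: (aeI (aP (sf_value b)) IH); apply: aeS => t [Pb Pl] b'.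
  by rewrite in_cons => /predU1P[->//|/Pl].
apply: aeS => t Pt; have [b /sf_evalE ->] := sf_cell_cover s t.
by apply: Pt; rewrite mem_enum.
Qed.

(** Almost every [t] is a Lebesgue point of [r |-> |s r - x|] for all the values
    [x] of [s], in particular for [x = s t], where this function vanishes at [t].
    The backward window is half of the centred ball, whence the factor 2. *)
Lemma bavg_sf_cvg s : {ae mu, forall t,
  (fun n => bavg n (fun t r => `|sf_eval s r - sf_eval s t|) t) @ \oo --> 0%E}.
Proof.
move: (ae_sf_value s (sf_dist_lebesgue_pt s)); apply: aeS => t.
set phi := fun r => _; move=> lpt.
have h0 : (fun n => n.+1%:R^-1 : R) @ \oo --> (0 : R)^'+.
  move=> B [e /= e0 eB]; suff : \forall n \near \oo, B n.+1%:R^-1 by [].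
  near=> n.
  have n0 : 0 < n.+1%:R^-1 :> R by rewrite invr_gt0.
  apply: eB n0 => /=; rewrite sub0r normrN ger0_norm ?invr_ge0//.
  by near: n; exact: near_natSinv_lt.
have := cvg_comp _ _ h0 lpt.
move=> d0; apply: (@squeeze_cvge _ _ _ _ (cst 0%E) _
    (fun n => (2%:E * davg phi t n.+1%:R^-1)%E)); last 2 first.
- exact: cvg_cst.
- rewrite -[X in _ --> X](mule0 2%:E); apply: cvgeZl => //.
near=> n; apply/andP; split; first by apply: bavg_ge0.
have hn : 0 < n.+1%:R^-1 :> R by rewrite invr_gt0.
rewrite /davg /iavg (lebesgue_measure_ball _ (ltW hn)).
rewrite inver mulrn_eq0/= gt_eqF//= muleA -EFinM.
rewrite -[n.+1%:R^-1 *+ 2]mulr_natl invfM mulrA mulfV// mul1r invrK.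
rewrite lee_wpmul2l//.
apply: (@le_trans _ _ (\int[mu]_(r in ball t n.+1%:R^-1) `|sf_eval s r - sf_eval s t|%:E)%E).
  apply: ge0_subset_integral => //.
  - exact: measurable_ball.
  - apply/measurable_EFinP; apply: measurable_funTS.
    exact: (sf_eval_measurable_fun s (fun y => `|y - sf_eval s t|)).
  - move=> r /=; rewrite in_itv/= => /andP[tr rt].
    by rewrite /ball/= ger0_norm ?subr_ge0// ltrBlDr addrC -ltrBlDr.
apply: le_integral_nomeas => r _; first by rewrite lee_fin.
by rewrite lee_fin /phi/= subrr normr0 subr0 normr_id.
Unshelve. all: by end_near. Qed.

End simple_density.

Section L2_translation.
Context {R : realType} (T : R) (X : normedModType R).
Local Notation mu := (@lebesgue_measure R).
Implicit Types (m : R -> R) (n : nat) (t r : R).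

Let I : set R := `]0, T[.

Lemma sqr_integrable_integrable m : measurable_fun setT m -> (forall t, 0 <= m t) ->
  (\int[mu]_(t in I) (m t ^+ 2)%:E < +oo)%E -> mu.-integrable I (EFin \o m).
Proof.
move=> mm m0 m2.
apply: (@le_integrable _ (measurableTypeR R) R mu I _ _ (fun t => (1 + m t ^+ 2)%:E)) => //.
- exact: measurable_itv.
- by apply/measurable_EFinP; exact: measurable_funTS.
- move=> t _; rewrite /= lee_fin !ger0_norm ?addr_ge0 ?sqr_ge0//.
  have := sqr_ge0 (m t - 1); have := sqr_ge0 (m t); nra.
- have i1 : mu.-integrable I (EFin \o cst (1 : R)).
    by apply: continuous_integrable => t; exact: cvg_cst.
  have i2 : mu.-integrable I (EFin \o (fun t => m t ^+ 2)).
    apply/integrableP; split.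
      by apply/measurable_EFinP; apply: measurable_funTS; exact: measurable_funX.
    apply: le_lt_trans m2; apply: le_integral_nomeas => // t _.
    by rewrite /= ger0_norm ?sqr_ge0.
  by have := integrableD _ i1 i2; apply; exact: measurable_itv.
Qed.

Lemma integral_bavg_sf_cvg (s : simple_fun T X) m : measurable_fun setT m ->
  (forall t, 0 <= m t) -> mu.-integrable I (EFin \o m) ->
  (fun n => \int[mu]_(t in I)
     ((m t)%:E * bavg n (fun t r => `|sf_eval s r - sf_eval s t|%R) t))%E @ \oo --> 0%E.
Proof.
move=> mm m0 im; have [C C0 sC] := sf_bounded s.
have js : jointly_measurable (fun t r => `|sf_eval s r - sf_eval s t|).
  exact: (sf_eval2_measurable_fun s s (fun x y => `|y - x|)).
have dom n t : (bavg n (fun t r => `|sf_eval s r - sf_eval s t|%R) t <= (2 * C)%:E)%E.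
  rewrite -(bavg_cst n (fun=> 2 * C) t); apply: bavg_le => // r.
  by rewrite mulrDl mul1r; apply: le_trans (ler_normB _ _) _; exact: lerD.
rewrite -[X in _ --> X](integral0 mu I).
have mf n : measurable_fun I
    (fun t => (m t)%:E * bavg n (fun t r => `|sf_eval s r - sf_eval s t|%R) t)%E.
  apply: emeasurable_funM; first by apply/measurable_EFinP; exact: measurable_funTS.
  by apply: measurable_funTS; exact: bavg_measurable.
have cv : {ae mu, forall t, I t ->
    (fun n => (m t)%:E * bavg n (fun t r => `|sf_eval s r - sf_eval s t|%R) t)%E @ \oo -->
    cst 0%E t}.
  move: (bavg_sf_cvg s); apply: aeS => t bt _.
  by rewrite -[X in _ --> X](mule0 (m t)%:E); apply: cvgeZl.
have i2 : mu.-integrable I (fun t => (2 * C * m t)%:E).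
  by have := integrableZl _ (2 * C) im; apply; exact: measurable_itv.
have dom2 : {ae mu, forall t, forall n, I t ->
    (`|(m t)%:E * bavg n (fun t r => `|sf_eval s r - sf_eval s t|%R) t| <=
     (2 * C * m t)%:E)%E}.
  apply: aeW => t n _; rewrite gee0_abs; last by rewrite mule_ge0 ?lee_fin ?bavg_ge0.
  by rewrite EFinM muleC; apply: lee_wpmul2r; [rewrite lee_fin|exact: dom].
have mI : measurable I by exact: measurable_itv.
by have [] := @dominated_convergence _ (measurableTypeR R) R mu I mI _ _ _ mf
  (measurable_cst _) cv i2 dom2.
Qed.

(** Split [g] into a simple function [s'] and an error [d = |g - s'|] that is small
    in L^2. The products [m t * d r] and [m t * d t] are bounded by
    [l d^2 + m^2 / l] with a large [l]: averaging preserves the integral of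
    [d r ^+ 2], and [d] is chosen small compared with [l]. The oscillation of [s']
    is handled by [integral_bavg_sf_cvg]. The bound [P n] is given as a separate
    function because it is visibly Borel measurable, so that bounds for several
    [g] can be added under the integral sign. *)
Lemma L2_backward (s : nat -> simple_fun T X) g m : sf_limit s g ->
  sqr_integrable T g -> measurable_fun setT m -> (forall t, 0 <= m t) ->
  (\int[mu]_(t in I) (m t ^+ 2)%:E < +oo)%E ->
  forall e : R, 0 < e -> exists P : nat -> R -> \bar R,
  [/\ forall n, measurable_fun setT (P n), forall n t, (0 <= P n t)%E,
      forall n t, ((m t)%:E * bavg n (fun t r => `|g r - g t|%R) t <= P n t)%E &
      \forall n \near \oo, (\int[mu]_(t in I) P n t <= e%:E)%E].
Proof.
move=> sg g2 mm m0 m2 eps eps0.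
have im := sqr_integrable_integrable mm m0 m2.
set M2 := (\int[mu]_(t in I) (m t ^+ 2)%:E)%E in m2.
have M20 : (0 <= M2)%E by apply: integral_ge0 => t _; rewrite lee_fin sqr_ge0.
have M2f : M2 = (fine M2)%:E by rewrite fineK// ge0_fin_numE.
have fM2 : 0 <= fine M2 by exact: fine_ge0.
(* [l] is chosen so that the total weight of [m^2], (2 / l) M2, is at most
   eps / 4; then the two contributions of [d^2] are at most eps / 8 each. *)
pose l := 8 * (fine M2 + 1) / eps.
have l0 : 0 < l by rewrite divr_gt0// mulr_gt0// ltr_wpDl.
have [s' es] : exists s' : simple_fun T X,
    (\int[mu]_(t in I) (`|g t - sf_eval s' t| ^+ 2)%:E < (eps / (8 * l))%R%:E)%E.
  by apply: (sf_dense sg g2); rewrite divr_gt0// mulr_gt0.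
pose d t := `|g t - sf_eval s' t|.
have md : measurable_fun setT d by exact: (sf_dist_measurable s' sg).
have md2 : measurable_fun setT (fun t => d t ^+ 2) by exact: measurable_funX.
have d0 t : 0 <= d t by exact: normr_ge0.

pose D t r := `|sf_eval s' r - sf_eval s' t|.
have D0 t r : 0 <= D t r by exact: normr_ge0.
have jD : jointly_measurable D.
  exact: (sf_eval2_measurable_fun s' s' (fun x y => `|y - x|)).
pose B n t := (l%:E * bavg n (fun _ r => (d r ^+ 2)%R) t)%E.
pose b t := l * d t ^+ 2 + 2 / l * m t ^+ 2.
pose S n t := ((m t)%:E * bavg n D t)%E.
have jd : jointly_measurable (fun _ r => d r ^+ 2) by exact: measurableT_comp.
have B0 n t : (0 <= B n t)%E.
  by rewrite mule_ge0 ?lee_fin ?(ltW l0)// bavg_ge0// => r; rewrite sqr_ge0.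
have l2 : 0 <= 2 / l by apply: divr_ge0 => //; exact: ltW.
have b0 t : 0 <= b t.
  by apply: addr_ge0; apply: mulr_ge0; rewrite ?sqr_ge0 ?l2 ?(ltW l0).
have S0 n t : (0 <= S n t)%E by rewrite mule_ge0 ?lee_fin ?bavg_ge0.
have mB n : measurable_fun setT (B n).
  by apply: emeasurable_funM => //; apply: bavg_measurable => // t r; rewrite sqr_ge0.
have mb : measurable_fun setT b.
  by apply: measurable_funD; apply: measurable_funM => //; exact: measurable_funX.
have mS n : measurable_fun setT (S n).
  apply: emeasurable_funM; last exact: bavg_measurable.
  exact/measurable_EFinP.
exists (fun n t => B n t + (b t)%:E + S n t)%E; split.
- move=> n; apply: emeasurable_funD => //; apply: emeasurable_funD => //.
  exact/measurable_EFinP.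
- by move=> n t; rewrite !adde_ge0 ?lee_fin.
- move=> n t; have mg : measurable_fun setT (fun r => `|g r - g t|).
    exact: sf_limit_norm_measurable sg.
  have mD : measurable_fun setT (D t) by exact: jointly_measurable_slice.
  have -> : (B n t + (b t)%:E + S n t =
      bavg n (fun t' r => (l * d r ^+ 2 + b t' + m t * D t' r)%R) t)%E.
    rewrite (@bavgD _ n (fun t' r => l * d r ^+ 2 + b t') (fun t' r => m t * D t' r)).
    - rewrite (@bavgD _ n (fun _ r => l * d r ^+ 2) (fun t' _ => b t')).
      + rewrite !bavgZ ?bavg_cst ?(ltW l0)// => r; exact: sqr_ge0.
      + by move=> r; rewrite mulr_ge0 ?sqr_ge0 ?(ltW l0).
      + by [].
      + exact: measurable_funM.
      + exact: measurable_cst.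
    - by move=> r; rewrite addr_ge0// mulr_ge0 ?sqr_ge0 ?(ltW l0).
    - by move=> r; rewrite mulr_ge0.
    - by apply: measurable_funD; [exact: measurable_funM|exact: measurable_cst].
    - exact: measurable_funM.
  rewrite -(@bavgZ _ n (fun t' r => `|g r - g t'|))//.
  apply: bavg_le => r; first by rewrite mulr_ge0.
  have tri : `|g r - g t| <= d r + d t + D t r.
    rewrite /d /D -[`|g t - _|]distrC -addrA [X in _ <= _ + X]addrC addrA.
    rewrite (_ : g r - g t = (g r - sf_eval s' r) + (sf_eval s' r - sf_eval s' t)
      + (sf_eval s' t - g t)).
      by apply: le_trans (ler_normD _ _) _; rewrite lerD2r; exact: ler_normD.
    by rewrite !addrA !subrK.
  apply: le_trans (ler_wpM2l (m0 t) tri) _; rewrite mulrDr lerD2r /b.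
  have amgm x : m t * x <= l * x ^+ 2 + m t ^+ 2 / l.
    rewrite -subr_ge0 (_ : _ - _ =
      l * ((x - (m t / l) / 2) ^+ 2 + 3 / 4 * (m t / l) ^+ 2)).
      apply: mulr_ge0; first exact: ltW.
      by apply: addr_ge0; [exact: sqr_ge0|apply: mulr_ge0; [lra|exact: sqr_ge0]].
    by field; rewrite gt_eqF.
  rewrite mulrDr; apply: le_trans (lerD (amgm _) (amgm _)) _.
  by rewrite le_eqVlt; apply/orP; left; apply/eqP; field; rewrite gt_eqF.
have [N _ SN] : \forall n \near \oo, (\int[mu]_(t in I) S n t < (eps / 2)%R%:E)%E.
  have := integral_bavg_sf_cvg s' mm m0 im.
  move=> /(_ [set y | (y < (eps / 2)%R%:E)%E]); apply.
  apply: open_nbhs_nbhs; split; first exact: open_ereal_lt_ereal.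
  by rewrite /= lte_fin divr_gt0.
exists N => // n /SN {}SN.
have mI : measurable I by exact: measurable_itv.
have mBI : measurable_fun I (B n) by exact: measurable_funTS.
have mbI : measurable_fun I (EFin \o b) by apply/measurable_EFinP; exact: measurable_funTS.
have mSI : measurable_fun I (S n) by exact: measurable_funTS.
have md2I : measurable_fun I (fun t => (d t ^+ 2)%:E).
  by apply/measurable_EFinP; exact: measurable_funTS.
have mm2I : measurable_fun I (fun t => (m t ^+ 2)%:E).
  by apply/measurable_EFinP; apply: measurable_funTS; exact: measurable_funX.
have intd : (\int[mu]_r (d r ^+ 2)%:E = \int[mu]_(r in I) (d r ^+ 2)%:E)%E.
  rewrite [RHS]integral_mkcond; apply: eq_integral => r _; rewrite patchE.
  case: ifPn => //; rewrite notin_setE => rI.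
  by rewrite /d (sf_limit_out sg rI) sf_eval_out// subrr normr0 expr0n.
have leB : (\int[mu]_(t in I) B n t <= (eps / 8)%R%:E)%E.
  apply: (@le_trans _ _ (\int[mu]_t B n t)%E).
    by apply: (@ge0_subset_integral _ (measurableTypeR R) R mu I setT) => //; exact: mB.
  have b2m : measurable_fun setT (bavg n (fun _ r => d r ^+ 2)).
    by apply: bavg_measurable => // t r; rewrite sqr_ge0.
  rewrite /B ge0_integralZl//; last 2 first.
  - by move=> t _; apply: bavg_ge0 => r; rewrite sqr_ge0.
  - by rewrite lee_fin ltW.
  rewrite integral_bavg//; last by move=> r; rewrite sqr_ge0.
  rewrite intd muleC -lee_pdivlMr//; apply: le_trans (ltW es) _.
  by rewrite -EFinM lee_fin invfM mulrA.
have leb : (\int[mu]_(t in I) (b t)%:E <= (eps / 8 + 2 / l * fine M2)%R%:E)%E.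
  have d2_ge0 t : I t -> (0 <= (d t ^+ 2)%:E)%E by rewrite lee_fin sqr_ge0.
  have m2_ge0 t : I t -> (0 <= (m t ^+ 2)%:E)%E by rewrite lee_fin sqr_ge0.
  have -> : (\int[mu]_(t in I) (b t)%:E =
      l%:E * \int[mu]_(t in I) (d t ^+ 2)%:E + (2 / l)%R%:E * M2)%E.
    rewrite /M2 -!ge0_integralZl ?lee_fin ?(ltW l0)//.
    rewrite -ge0_integralD//.
    - by move=> t It; rewrite mule_ge0 ?d2_ge0 ?lee_fin ?(ltW l0).
    - exact: emeasurable_funM.
    - by move=> t It; rewrite mule_ge0 ?m2_ge0 ?lee_fin.
    - exact: emeasurable_funM.
  rewrite EFinD; apply: leeD; last by rewrite [leRHS]EFinM -M2f.
  rewrite muleC -lee_pdivlMr//; apply: le_trans (ltW es) _.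
  by rewrite -EFinM lee_fin invfM mulrA.
rewrite ge0_integralD//; last 2 first.
- by move=> t _; rewrite adde_ge0 ?lee_fin.
- exact: emeasurable_funD.
rewrite ge0_integralD//; last by move=> t _; rewrite lee_fin.
apply: le_trans (leeD (leeD leB leb) (ltW SN)) _; rewrite -!EFinD lee_fin.
have : 2 / l * fine M2 <= eps / 4.
  have -> : 2 / l * fine M2 = eps / 4 * (fine M2 / (fine M2 + 1)).
    by rewrite /l; field; rewrite !gt_eqF// ltr_wpDl.
  rewrite ler_piMr ?divr_ge0 ?(ltW eps0)// ler_pdivrMr ?ltr_wpDl//.
  by rewrite mul1r lerDl.
lra.
Qed.

End L2_translation.

(** * A Gronwall lemma for averaged inequalities *)

Section gronwall.
Context {R : realType}.
Local Notation mu := (@lebesgue_measure R).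
Implicit Types (y : R -> R) (n : nat) (t r : R).

(** Integrating from minus infinity is possible as [y] vanishes there, and it makes
    the primitive differentiable on the whole line, the origin included. *)
Lemma primitive_exists y : continuous y -> (forall t, 0 <= y t) ->
  (forall t, t <= 0 -> y t = 0) ->
  exists Y : R -> R, [/\ forall t, is_derive t 1 Y (y t), Y 0 = 0 & forall t, 0 <= Y t].
Proof.
move=> cy y0 yneg.
have iy u : mu.-integrable `]-oo, u] (EFin \o y).
  apply/integrableP; split.
    apply/measurable_EFinP; apply: measurable_funTS; exact: continuous_measurable_fun.
  have iu : mu.-integrable `[0, u] (EFin \o y) by exact: continuous_integrable.
  have /integrableP[_] := iu.
  rewrite integral_mkcond [X in _ -> (X < _)%E]integral_mkcond.
  congr (_ < _)%E; apply: eq_integral => t _; rewrite !patchE.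
  have [t0|t0] := leP t 0.
    by rewrite /= yneg// normr0; case: ifP => _; case: ifP.
  congr (if _ then _ else _); apply/idP/idP => /set_mem/=; rewrite in_itv/= => tu;
    by apply/mem_set; rewrite /= in_itv/= ?(ltW t0)//; case/andP: tu.
exists (fun t => \int[mu]_(r in `]-oo, t]) y r); split.
- move=> t; have t1 : t < t + 1 by rewrite ltrDl.
  have Ny : ((-oo%O : itv_bound R) < BRight t)%E by rewrite ltNyr.
  have [d1 d2] := continuous_FTC1 t1 (iy (t + 1)) Ny (cy t).
  by apply: DeriveDef; [exact: d1|rewrite -derive1E; exact: d2].
- transitivity (\int[mu]_(r in `]-oo, 0]) (cst 0 r : R)).
    by apply: eq_Rintegral => t; rewrite inE/= in_itv/= => /yneg.
  by rewrite Rintegral_cst// mul0r.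
- by move=> t; apply: Rintegral_ge0.
Qed.

Lemma difference_quotient (Y y : R -> R) a n : (forall t, is_derive t 1 Y (y t)) ->
  exists2 c, a < c < a + n.+1%:R^-1 & n.+1%:R * (Y (a + n.+1%:R^-1) - Y a) = y c.
Proof.
move=> dY; have h0 : a < a + n.+1%:R^-1 by rewrite ltrDl invr_gt0.
have [c cI ->] : exists2 c, c \in `]a, a + n.+1%:R^-1[ &
    Y (a + n.+1%:R^-1) - Y a = y c * (a + n.+1%:R^-1 - a).
  apply: MVT => //; apply: derivable_within_continuous => t _.
  by have [] := dY t.
exists c; first by rewrite in_itv in cI.
by rewrite addrAC subrr add0r mulrCA mulfV// mulr1.
Qed.

(** [Y t * exp (- K t)] is nonincreasing. *)
Lemma gronwall (Y y : R -> R) K T : (forall t, is_derive t 1 Y (y t)) ->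
  Y 0 = 0 -> (forall t, 0 < t < T -> y t <= K * Y t) ->
  forall t, 0 < t < T -> Y t <= 0.
Proof.
move=> dY Y0 yK t /andP[t0 tT].
pose Z r := Y r * expR (- (K * r)).
have dZ r : is_derive r 1 Z ((y r - K * Y r) * expR (- (K * r))).
  have dl : is_derive r 1 (fun r => - (K * r)) (- K).
    rewrite (_ : (fun r => - (K * r)) = (fun r => - K * r + 0)).
      exact: is_derive_affine.
    by apply/funext => x; rewrite addr0 mulNr.
  have dE : is_derive r 1 (fun r => expR (- (K * r))) (expR (- (K * r)) * - K).
    exact: (is_derive1_comp (f := expR)).
  have := is_deriveM (dY r) dE; move/is_derive_eq; apply.
  by rewrite /GRing.scale/=; ring.
have : Z t <= Z 0.
  apply: (@ler0_derive1_nincr _ Z 0 t) => //.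
  - move=> r; rewrite in_itv/= => /andP[r0 rt].
    have := dZ r => dr; rewrite derive1E derive_val.
    rewrite mulr_le0_ge0 ?expR_ge0// subr_le0 yK// r0.
    exact: lt_trans tT.
  - by apply: derivable_within_continuous => r _; have [] := dZ r.
  - exact: ltW.
rewrite /Z Y0 mul0r => Zt.
by move: Zt; rewrite pmulr_lle0// expR_gt0.
Qed.

(** Integrated over ]h, t], the difference quotients of [y] telescope: they leave
    the difference between the mean of [y] over [t - h, t] and its mean over
    [0, h]. By continuity the first is nearly [y t] and the second nearly
    [y 0 = 0]. Hence [y t <= K Y t] for the primitive [Y] of [y], and [gronwall]
    applies. Extending [y] by 0 to the left of the origin keeps [t - h] harmless. *)
Lemma averaged_gronwall T y K : 0 <= K -> continuous y -> (forall t, 0 <= y t) ->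
  (forall t, t <= 0 -> y t = 0) ->
  (forall e, 0 < e -> exists P : nat -> R -> \bar R,
    [/\ forall n, measurable_fun setT (P n), forall n t, (0 <= P n t)%E,
        \forall n \near \oo, (\int[mu]_(t in `]0%R, T[) P n t <= e%:E)%E &
        forall n, {ae mu, forall t, n.+1%:R^-1 < t -> t < T ->
          ((n.+1%:R * (y t - y (t - n.+1%:R^-1)) - K * y t)%R%:E <= P n t)%E}]) ->
  forall t, 0 < t < T -> y t = 0.
Proof.
move=> K0 cy y0 yneg yP.
have [Y [dY Y0 Yge0]] := primitive_exists cy y0 yneg.
have yY t : 0 < t < T -> y t <= K * Y t.
  move=> /andP[t0 tT]; apply/ler_addgt0Pr => e e0.
  pose e' := e / 3; have e'0 : 0 < e' by rewrite divr_gt0.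
  have [P [mP P0 PI Pae]] := yP e' e'0.
  have near_t : \forall n \near \oo, forall c, t - n.+1%:R^-1 < c < t -> y t - e' <= y c.
    have /cvgrPdist_le/(_ e' e'0)[d /= d0 yd] := cy t.
    have hd : \forall n \near \oo, n.+1%:R^-1 < d by exact: near_natSinv_lt.
    apply: filterS hd => n hd c /andP[tc ct].
    have : `|y t - y c| <= e'.
      apply: yd => /=; rewrite ger0_norm ?subr_ge0 ?(ltW ct)// ltrBlDl -ltrBlDr.
      by apply: le_lt_trans tc; rewrite lerD2l lerN2; exact: ltW.
    by rewrite ler_norml lerBlDl -lerBlDr => /andP[].
  have near_0 : \forall n \near \oo, forall c, 0 < c < n.+1%:R^-1 -> y c <= e'.
    have /cvgrPdist_le/(_ e' e'0)[d /= d0 yd] := cy 0.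
    have hd : \forall n \near \oo, n.+1%:R^-1 < d by exact: near_natSinv_lt.
    apply: filterS hd => n hd c /andP[c0 ch].
    have : `|y 0 - y c| <= e'.
      by apply: yd => /=; rewrite sub0r normrN gtr0_norm// (lt_trans ch).
    by rewrite yneg// sub0r normrN ger0_norm.
  near \oo => n.
  have yt c : t - n.+1%:R^-1 < c < t -> y t - e' <= y c.
    by move: c; near: n; exact: near_t.
  have yz c : 0 < c < n.+1%:R^-1 -> y c <= e'.
    by move: c; near: n; exact: near_0.
  have PIn : (\int[mu]_(r in `]0%R, T[) P n r <= e'%:E)%E by near: n; exact: PI.
  have : n.+1%:R^-1 < t by near: n; exact: near_natSinv_lt.
  set h : R := n.+1%:R^-1 => ht.
  have h0 : 0 < h by rewrite invr_gt0.
  pose G r := n.+1%:R * (Y r - Y (r - h)) - K * Y r.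
  pose f r := n.+1%:R * (y r - y (r - h)) - K * y r.
  have dG r : is_derive r 1 G (f r).
    have dYh : is_derive r 1 (fun r => Y (r - h)) (y (r - h)).
      have dYr : derivable Y (1 * r - h) 1 by have [] := dY (1 * r - h).
      have := derive1_affine_comp dYr; have dYr' := dY (1 * r - h).
      rewrite derive1E derive_val mulr1 mul1r.
      by congr (is_derive _ _ _ _); apply/funext => x; rewrite mul1r.
    have := is_deriveB (is_deriveZ n.+1%:R (is_deriveB (dY r) dYh)) (is_deriveZ K (dY r)).
    by [].
  have cyh : continuous (fun r => y (r - h)).
    move=> r; apply: (@continuous_comp _ _ _ (fun r => r - h) y); last exact: cy.
    by apply: cvgB; [exact: cvg_id|exact: cvg_cst].
  have cf : continuous f.
    move=> r; apply: cvgB; last by apply: cvgMr; exact: cy.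
    apply: cvgMr; apply: cvgB; first exact: cy.
    exact: cyh.
  have dGE : derive1 G = f.
    by apply/funext => r; rewrite derive1E; have dGr := dG r; rewrite derive_val.
  have intf : \int[mu]_(r in `]h, t]) f r = G t - G h.
    rewrite -dGE; apply: Rintegral_derive1; rewrite ?dGE// ?ltW//.
  have : G t - G h <= e'.
    rewrite -intf -lee_fin /Rintegral fineK; last first.
      by apply: integrable_fin_num => //; exact: continuous_integrable.
    apply: (@le_trans _ _ (\int[mu]_(r in `]h, t]) ((EFin \o f)^\+ r))%E).
      by rewrite integralE -[leRHS]sube0 leeB// integral_ge0.
    apply: (@le_trans _ _ (\int[mu]_(r in `]h, t]) P n r)%E).
      apply: ae_le_integral_nomeas => //.
      move: (Pae n); apply: aeS => r Pr; rewrite /= in_itv/= => /andP[hr rt].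
      by rewrite funeposE ge_max P0 Pr// (le_lt_trans rt).
    apply: (@le_trans _ _ (\int[mu]_(r in `]0%R, T[) P n r)%E) => //.
    apply: (@ge0_subset_integral _ (measurableTypeR R) R mu) => //.
    - by apply: measurable_funTS; exact: mP.
    - move=> r /=; rewrite !in_itv/= => /andP[hr rt].
      by rewrite (lt_trans h0 hr) (le_lt_trans rt).
  have [c1 c1t] := difference_quotient (t - h) n dY.
  have [c2 c2h] := difference_quotient 0 n dY.
  rewrite subrK in c1t *; rewrite add0r in c2h *.
  rewrite /G subrr -/h => q2 q1.
  have y1 : y t - e' <= y c1 by exact: yt c1t.
  have y2 : y c2 <= e' by exact: yz c2h.
  have Kh : 0 <= K * Y h by rewrite mulr_ge0.
  rewrite q1 q2 => Ge; rewrite /e' in y1 y2 Ge; lra.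
move=> t tT; apply/eqP; rewrite eq_le y0 andbT.
apply: le_trans (yY t tT) _; rewrite mulr_ge0_le0//.
exact: (gronwall dY Y0 yY).
Unshelve. all: by end_near. Qed.

End gronwall.

(** * The energy inequality *)

Section inner_products.
Context {R : realType} {H : completeNormedModType R} (p : inner_product H).
Implicit Types x y z : H.

Lemma ipBl x y z : p (x - y) z = p x z - p y z.
Proof.
by rewrite addrC -scaleN1r ip_linear mulN1r addrC.
Qed.

Lemma ip_continuousl h : continuous (fun x => p x h : R^o).
Proof.
have lp : linear (fun x => p x h : R^o).
  by move=> a x y; rewrite ip_linear.
pose g : {linear H -> R^o} := HB.pack (fun x => p x h : R^o)
  (GRing.isLinear.Build _ _ _ _ _ lp).
apply: (@bounded_linear_continuous _ _ _ g); apply/bounded_funP => r.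
exists (r * `|h|) => x xr; apply: le_trans (ip_cauchy_schwarz p _ _) _.
by rewrite ler_wpM2r.
Qed.

(** The difference of the two sides is [- |x - y|^2]. *)
Lemma sqr_norm_diff_le x y : `|x| ^+ 2 - `|y| ^+ 2 <= 2 * p (x - y) x.
Proof.
have := sqr_ge0 `|x - y|; rewrite -!(ip_norm p) !ipBl.
rewrite (ipC p x (x - y)) (ipC p y (x - y)) !ipBl (ipC p y x); lra.
Qed.

End inner_products.

Section pairing_average.
Context {R : realType} (T : R) (X : normedModType R).
Local Notation mu := (@lebesgue_measure R).
Implicit Types (g : R -> dual X) (s : nat -> simple_fun T (dual X)) (v : X).

Lemma sf_limit_dual_measurable s g v : sf_limit s g ->
  measurable_fun setT (fun t => g t v : R).
Proof.
move=> sg.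
have cv : continuous (fun f : dual X => f v : R) by exact: dual_eval_continuous.
have mv := sf_limit_measurable sg cv; exact: mv.
Qed.

Lemma integrable_dual s g v : sf_limit s g -> sqr_integrable T g ->
  mu.-integrable `]0, T[ (EFin \o (fun t => g t v : R)).
Proof.
move=> sg g2.
have mg : measurable_fun setT (fun t => `|g t|).
  by apply: eq_measurable_fun (sf_limit_norm_measurable 0 sg) => t _; rewrite subr0.
have ig := sqr_integrable_integrable mg (fun t => normr_ge0 (g t)) g2.
apply: (@le_integrable _ (measurableTypeR R) R mu `]0, T[%classic _ _
  (fun t => (`|v| * `|g t|)%:E)) => //.
- by apply/measurable_EFinP; apply: measurable_funTS; exact: sf_limit_dual_measurable sg.
- move=> t _; rewrite /= lee_fin (@ger0_norm _ (_ * _)) ?mulr_ge0// mulrC.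
  exact: dual_ler.
- by have := integrableZl _ `|v| ig; apply; exact: measurable_itv.
Qed.

(** The mean of the constant [g t v] is [g t v], so the difference is the mean of
    [(g r - g t) v]. *)
Lemma bavg_pairing s g v n t : sf_limit s g -> sqr_integrable T g ->
  n.+1%:R^-1 < t -> t < T ->
  (`|n.+1%:R * \int[mu]_(r in `](t - n.+1%:R^-1)%R, t]) (g r v : R) - g t v|%:E <=
   `|v|%:E * bavg n (fun t r => `|g r - g t|%R) t)%E.
Proof.
move=> sg g2 nt tT.
have sub : `](t - n.+1%:R^-1), t]%classic `<=` `]0, T[%classic.
  move=> r /=; rewrite !in_itv/= => /andP[tr rt].
  by rewrite (le_lt_trans _ tr) ?subr_ge0 ?(ltW nt)// (le_lt_trans rt).
have ig : mu.-integrable `](t - n.+1%:R^-1), t] (EFin \o (fun r => g r v : R)).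
  by have := integrable_dual v sg g2; apply: integrableS.
have ic : mu.-integrable `](t - n.+1%:R^-1), t] (EFin \o (fun r => g t v : R)).
  by apply: continuous_integrable => r; exact: cvg_cst.
have icst : \int[mu]_(r in `](t - n.+1%:R^-1)%R, t]) (g t v : R) = n.+1%:R^-1 * g t v.
  rewrite Rintegral_cst// mulrC; congr (_ * _).
  by rewrite [X in fine X]mu_itv_oc.
rewrite (_ : _ - g t v = n.+1%:R * \int[mu]_(r in `](t - n.+1%:R^-1)%R, t]) (g r v - g t v)); last first.
  by rewrite RintegralB// icst mulrBr mulrA mulfV// mul1r.
rewrite normrM ger0_norm// EFinM /bavg muleCA; apply: lee_wpmul2l => //.
have iB : mu.-integrable `](t - n.+1%:R^-1), t] (EFin \o (fun r => g r v - g t v : R)).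
  by have := integrableB _ ig ic; apply.
rewrite EFin_normr_Rintegral//.
apply: le_trans (le_abse_integral _ _ _) _ => //; first by case/integrableP: iB.
rewrite -ge0_integralZl//; last first.
  by apply/measurable_EFinP; apply: measurable_funTS; exact: sf_limit_norm_measurable sg.
apply: le_integral_nomeas => r _ //.
by rewrite /= -EFinM lee_fin mulrC; exact: (dual_ler (g r - g t) v).
Qed.

End pairing_average.

Section weak_derivatives.
Context {R : realType} {V H : completeNormedModType R}.
Local Notation mu := (@lebesgue_measure R).
Variables (T : R) (E : evolution_triple V H).

Lemma integrable_bounded_mul (phi q : R -> R) : continuous phi -> 0 < T ->
  mu.-integrable `]0, T[ (EFin \o q) ->
  mu.-integrable `]0, T[ (EFin \o (fun t => phi t * q t)).
Proof.
move=> cphi T0 iq.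
have cn : {within `[0, T], continuous (fun t => `|phi t|)}.
  by apply: continuous_subspaceT => t; apply: cvg_norm; exact: cphi.
have [c _ cM] := EVT_max (ltW T0) cn.
apply: (@le_integrable _ (measurableTypeR R) R mu `]0, T[%classic _ _
  (fun t => (`|phi c| * `|q t|)%:E)) => //.
- apply/measurable_EFinP; apply: measurable_funM.
    by apply: measurable_funTS; exact: continuous_measurable_fun.
  by case/integrableP: iq => /measurable_EFinP.
- move=> t /=; rewrite in_itv/= => /andP[t0 tT].
  rewrite /= lee_fin [leRHS]ger0_norm ?mulr_ge0// normrM ler_wpM2r//.
  by apply: cM; rewrite in_itv/= !ltW.
- by have := integrableZl _ `|phi c| (integrable_norm iq); apply; exact: measurable_itv.
Qed.

(** Tested with a fixed [v], the weak derivative becomes a scalar one, to which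
    [du_bois_reymond] applies. The version [g] of [u'] and the continuous
    representative [w] of [u] replace the original functions, from which they
    differ on null sets only. *)
Lemma weak_derivative_increment (u : R -> V) (u' : R -> dual V) (w : R -> H)
    (s : nat -> simple_fun T (dual V)) (g : R -> dual V) : 0 < T ->
  is_weak_derivative T (fun t => emb E (u t)) u' ->
  continuous w -> {ae mu, forall t, t \in `]0, T[ -> w t = et_i E (u t)} ->
  sf_limit s g -> sqr_integrable T g ->
  {ae mu, forall t, t \in `]0, T[ -> g t = u' t} ->
  forall (v : V) a b, 0 < a -> a <= b -> b < T ->
    et_ip E (w b) (et_i E v) - et_ip E (w a) (et_i E v) =
    \int[mu]_(r in `]a, b]) (g r v : R).
Proof.
move=> T0 du cw wu sg g2 gu v a b a0 ab bT.
pose p t : R := et_ip E (w t) (et_i E v).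
have cp : continuous p.
  move=> t; apply: (@continuous_comp _ _ _ w (fun h => et_ip E h (et_i E v))); first exact: cw.
  exact: ip_continuousl.
apply: (@du_bois_reymond R T p (fun t => g t v) cp (integrable_dual v sg g2)) => //.
move=> phi phiT; have [x [bx1 bx2]] := du phi phiT.
have cphi : continuous phi by apply: derivable_continuous => t; exact: (phiT.1 0%N).
have cphi' : continuous (derive1 phi).
  by apply: derivable_continuous => t; exact: (phiT.1 1%N).
rewrite (bochner_pairing (x := x) (v := v) bx1); last 2 first.
- by apply: continuous_integrable => t; exact: (continuousM (cphi' t) (cp t)).
- move: wu; apply: aeS => t wu tT; rewrite /p wu//.
rewrite (bochner_pairing (x := - x) (v := v) bx2) ?opprK//.
- exact: integrable_bounded_mul (integrable_dual v sg g2).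
- by move: gu; apply: aeS => t gu tT; rewrite gu.
Qed.

Lemma continuous_clamp (X : topologicalType) (w : R -> X) : 0 <= T ->
  {within `[0, T], continuous w} ->
  continuous (fun t => w (Num.max 0 (Num.min t T))).
Proof.
move=> T0 /subspace_continuousP cw t.
have cI r : `[0, T]%classic (Num.max 0 (Num.min r T)).
  by rewrite /= in_itv/= le_max lexx/= ge_max T0 ge_min lexx orbT.
apply: (cvg_comp _ _ _ (cw _ (cI t))) => B /= wB.
have cc : (fun r => Num.max 0 (Num.min r T)) @ t --> Num.max 0 (Num.min t T).
  apply: (@continuous_max _ _ (cst 0) (id \min cst T)); first exact: cvg_cst.
  by apply: continuous_min; [exact: cvg_id|exact: cvg_cst].
by apply: (@filterS _ _ (nbhs_filter t) _ _ _ (cc _ wB)) => r; apply; exact: cI.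
Qed.

(** Freezing the representative outside [0, T] makes it continuous on the whole
    line, and constant before time 0 as [averaged_gronwall] requires. *)
Lemma initial_value_continuous u u0 : 0 < T -> initial_value T E u u0 ->
  exists w : R -> H, [/\ continuous w,
    {ae mu, forall t, t \in `]0, T[ -> w t = et_i E (u t)} &
    forall t, t <= 0 -> w t = u0].
Proof.
move=> T0 [w [cw wu w0]]; exists (fun t => w (Num.max 0 (Num.min t T))); split.
- exact: continuous_clamp (ltW T0) cw.
- move: wu; apply: aeS => t wu tT; rewrite -wu//; congr w.
  move: tT; rewrite in_itv/= => /andP[t0 tT].
  by rewrite min_l ?max_r// ltW.
- move=> t t0; rewrite min_l ?max_l//.
  exact: le_trans t0 (ltW T0).
Qed.

End weak_derivatives.

(** * Uniqueness *)

Section uniqueness.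
Context {R : realType} {V H U : completeNormedModType R}.
Local Notation mu := (@lebesgue_measure R).
Variables (T : R) (E : evolution_triple V H).
Variables (A : V -> dual V) (J : U -> R^o) (iota : {linear V -> U}).
Variables (a b alpha beta m1 m2 c m3 : R).
Hypotheses (HA1 : H_A1 E A a b alpha beta m1 m2) (HJ1 : H_J1 J c m3)
  (HU : H_U T E iota) (Hconst : H_const E iota m1 m3).

(** Either [iota] factors through [H], and [m3 |iota x|^2] is a multiple of
    [|i x|^2], or the term [m1 |x|^2] absorbs it. *)
Lemma pivot_dominates : exists2 C, 0 <= C & forall x : V,
  - (m1 * `|x| ^+ 2) + m2 * `|et_i E x| ^+ 2 + m3 * `|iota x| ^+ 2 <= C * `|et_i E x| ^+ 2.
Proof.
have m1_0 := HA1_m1 HA1; have m2_0 := HA1_m2 HA1; have m3_0 := HJ1_m3 HJ1.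
have [[p cp pE]|m13] := Hconst.
  exists (m2 + m3 * op_norm p ^+ 2).
    apply: addr_ge0; first exact: ltW.
    by apply: mulr_ge0; [exact: ltW|exact: sqr_ge0].
  move=> x; have px : `|iota x| ^+ 2 <= op_norm p ^+ 2 * `|et_i E x| ^+ 2.
    rewrite -pE -exprMn lerXn2r ?nnegrE ?mulr_ge0 ?op_norm_ge0//.
    exact: op_norm_ler.
  have := ler_wpM2l (ltW m3_0) px; have := mulr_ge0 m1_0 (sqr_ge0 `|x|).
  rewrite mulrDl mulrA; lra.
exists m2; first exact: ltW.
move=> x; have px : `|iota x| ^+ 2 <= op_norm iota ^+ 2 * `|x| ^+ 2.
  have cio := HU_continuous HU.
  rewrite -exprMn lerXn2r ?nnegrE ?mulr_ge0 ?op_norm_ge0//.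
  exact: op_norm_ler.
have := ler_wpM2l (ltW m3_0) px; have := ler_wpM2r (sqr_ge0 `|x|) m13.
rewrite mulrA; lra.
Qed.

(** The selections [xi1] and [xi2] of the subdifferentials may depend on the vector
    at which [eta1] and [eta2] are evaluated; only [x = v1 - v2] is used. *)
Lemma solutions_dissipative : exists2 C, 0 <= C &
  forall (v1 v2 : V) (f f1 f2 eta1 eta2 : dual V),
  f1 + A v1 + eta1 = f -> f2 + A v2 + eta2 = f ->
  (forall v, [set xi (iota v) | xi in clarke_subdiff J (iota v1)] (eta1 v)) ->
  (forall v, [set xi (iota v) | xi in clarke_subdiff J (iota v2)] (eta2 v)) ->
  f1 (v1 - v2) - f2 (v1 - v2) <= C * `|et_i E (v1 - v2)| ^+ 2.
Proof.
have [C C0 HC] := pivot_dominates; exists C => //.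
move=> v1 v2 f f1 f2 eta1 eta2 e1 e2 s1 s2; set x := v1 - v2.
have [xi1 xiJ1 xiE1] := s1 x; have [xi2 xiJ2 xiE2] := s2 x.
have HJ := HJ1_monotone HJ1 xiJ1 xiJ2; have HA := HA1_monotone HA1 v1 v2.
rewrite -/x in HA; rewrite -linearB -/x in HJ.
apply: le_trans (HC x).
have E1 : f1 x + A v1 x + eta1 x = f x by rewrite -e1.
have E2 : f2 x + A v2 x + eta2 x = f x by rewrite -e2.
have HA' : m1 * `|x| ^+ 2 - m2 * `|et_i E x| ^+ 2 <= A v1 x - A v2 x by exact: HA.
have HJ' : - m3 * `|iota x| ^+ 2 <= xi1 (iota x) - xi2 (iota x) by exact: HJ.
rewrite -xiE1 in E1; rewrite -xiE2 in E2; lra.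
Qed.

End uniqueness.

Theorem theorem3 (R : realType) (V H U : completeNormedModType R) (T : R)
    (E : evolution_triple V H) (A : V -> dual V) (J : U -> R^o)
    (iota : {linear V -> U}) (f : R -> dual V) (u0 : H)
    (a b alpha beta m1 m2 c m3 : R)
    (T_gt0 : 0 < T) (U_reflexive : reflexive_space U)
    (HA1 : H_A1 E A a b alpha beta m1 m2) (HJ1 : H_J1 J c m3)
    (H0 : L2 T f) (HU : H_U T E iota)
    (Haux : H_aux E J iota alpha c) (Hconst : H_const E iota m1 m3)
    (u1 u2 : R -> V)
    (sol1 : solution T E A J iota f u0 u1) (sol2 : solution T E A J iota f u0 u2) :
  {ae @lebesgue_measure R, forall t, t \in `]0, T[ -> u1 t = u2 t}.
Proof.
have [C C0 diss] := solutions_dissipative HA1 HJ1 HU Hconst.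
have [d1 [eta1 [W1 iv1 _ eq1 inc1]]] := sol1.
have [d2 [eta2 [W2 iv2 _ eq2 inc2]]] := sol2.
have [w1 [cw1 wu1 w1_0]] := initial_value_continuous T_gt0 iv1.
have [w2 [cw2 wu2 w2_0]] := initial_value_continuous T_gt0 iv2.
have [s1 [g1 [sg1 g1_2 gd1]]] := L2_version (W_deriv_L2 W1).
have [s2 [g2 [sg2 g2_2 gd2]]] := L2_version (W_deriv_L2 W2).
have [r1 [v1 [rv1 v1_2 vu1]]] := L2_version (W_L2 W1).
have [r2 [v2 [rv2 v2_2 vu2]]] := L2_version (W_L2 W2).
have incr1 := weak_derivative_increment T_gt0 (W_deriv W1) cw1 wu1 sg1 g1_2 gd1.
have incr2 := weak_derivative_increment T_gt0 (W_deriv W2) cw2 wu2 sg2 g2_2 gd2.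
pose w t := w1 t - w2 t; pose y t := `|w t| ^+ 2.
(* The weight of the oscillations: it dominates [2 |u1 t - u2 t|], the 2 coming
   from the expansion of the square. *)
pose m t := 2 * (`|v1 t| + `|v2 t|).
have mv (r : nat -> simple_fun T V) v : sf_limit r v -> measurable_fun setT (fun t => `|v t|).
  move=> rv.
  by apply: eq_measurable_fun (sf_limit_norm_measurable 0 rv) => t _; rewrite subr0.
have mm : measurable_fun setT m.
  by apply: measurable_funM => //; apply: measurable_funD; [exact: mv rv1|exact: mv rv2].
have m0 t : 0 <= m t by rewrite mulr_ge0// addr_ge0.
have m_2 : (\int[@lebesgue_measure R]_(t in `]0%R, T[) (m t ^+ 2)%:E < +oo)%E.
  have vM (r : nat -> simple_fun T V) v : sf_limit r v ->
      measurable_fun `]0, T[ (fun t => (`|v t| ^+ 2)%:E).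
    move=> rv; apply/measurable_EFinP; apply: measurable_funTS.
    by apply: measurable_funX; exact: mv rv.
  apply: (@le_lt_trans _ _ (\int[@lebesgue_measure R]_(t in `]0%R, T[)
      (8%:E * ((`|v1 t| ^+ 2)%:E + (`|v2 t| ^+ 2)%:E)))%E).
    apply: le_integral_nomeas => t _; first by rewrite lee_fin sqr_ge0.
    rewrite -EFinD -EFinM lee_fin /m; have := sqr_ge0 (`|v1 t| - `|v2 t|); nra.
  rewrite ge0_integralZl//; last 2 first.
  - by apply: emeasurable_funD; [exact: vM rv1|exact: vM rv2].
  - by move=> t _; rewrite adde_ge0// lee_fin sqr_ge0.
  rewrite lte_mul_pinfty// ge0_integralD//; last 2 first.
  - exact: vM rv1.
  - exact: vM rv2.
  exact: lte_add_pinfty.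
have cy : continuous y.
  move=> t; have cn : (fun t => `|w t|) @ t --> `|w t|.
    by apply: cvg_norm; apply: cvgB; [exact: cw1|exact: cw2].
  exact: (cvgM cn cn).
have y0 t : 0 <= y t by exact: sqr_ge0.
have yneg t : t <= 0 -> y t = 0.
  by move=> t0; rewrite /y /w w1_0// w2_0// subrr normr0 expr0n.
have y_eq0 : forall t, 0 < t < T -> y t = 0.
  apply: (@averaged_gronwall R T y (2 * C)) => //; first by rewrite mulr_ge0.
  move=> e e0; have e2 : 0 < e / 2 by rewrite divr_gt0.
  have [P1 [mP1 P1_0 bP1 iP1]] := L2_backward sg1 g1_2 mm m0 m_2 e2.
  have [P2 [mP2 P2_0 bP2 iP2]] := L2_backward sg2 g2_2 mm m0 m_2 e2.
  exists (fun n t => P1 n t + P2 n t)%E; split.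
  - by move=> n; exact: emeasurable_funD.
  - by move=> n t; rewrite adde_ge0.
  - near=> n; rewrite ge0_integralD//; last 2 first.
    + by apply: measurable_funTS; exact: mP1.
    + by apply: measurable_funTS; exact: mP2.
    rewrite [e]splitr EFinD; apply: leeD; first by near: n; exact: iP1.
    by near: n; exact: iP2.
  - move=> n.
    move: (aeI (aeI (aeI wu1 wu2) (aeI gd1 gd2)) (aeI (aeI vu1 vu2) (aeI (aeI eq1 eq2) (aeI inc1 inc2)))).
    apply: aeS => t [[[wu1t wu2t] [gd1t gd2t]] [[vu1t vu2t] [[eq1t eq2t] [inc1t inc2t]]]] nt tT.
    have t0 : 0 < t by apply: lt_trans nt; rewrite invr_gt0.
    have tI : t \in `]0, T[ by rewrite in_itv/= t0.
    set h : R := n.+1%:R^-1 in nt *.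
    have th0 : 0 < t - h by rewrite subr_gt0.
    have tht : t - h <= t by rewrite gerBl invr_ge0.
    set x := u1 t - u2 t.
    have wx : w t = et_i E x by rewrite /w wu1t// wu2t// -linearB.
    pose q1 := n.+1%:R * \int[@lebesgue_measure R]_(r in `]t - h, t]) (g1 r x : R).
    pose q2 := n.+1%:R * \int[@lebesgue_measure R]_(r in `]t - h, t]) (g2 r x : R).
    have step : n.+1%:R * (y t - y (t - h)) <= 2 * (q1 - q2).
      rewrite /q1 /q2 -incr1// -incr2// -mulrBr mulrCA ler_pM2l//.
      apply: le_trans (sqr_norm_diff_le (et_ip E) _ _) _.
      rewrite ler_pM2l// {2}wx /w !ipBl; lra.
    have dt : g1 t x - g2 t x <= C * y t.
      rewrite /y wx gd1t// gd2t//.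
      exact: diss (eq1t tI) (eq2t tI) (inc1t tI) (inc2t tI).
    have xm : 2 * `|x| <= m t.
      rewrite /m ler_pM2l// vu1t// vu2t//; exact: ler_normB.
    have bd (s : nat -> simple_fun T (dual V)) g (P : nat -> R -> \bar R)
        (sg : sf_limit s g) (g_2 : sqr_integrable T g)
        (bP : forall n t, ((m t)%:E * bavg n (fun t r => `|g r - g t|%R) t <= P n t)%E) :
        ((2 * `|n.+1%:R * \int[@lebesgue_measure R]_(r in `]t - h, t]) (g r x : R) - g t x|)%R%:E
          <= P n t)%E.
      apply: le_trans (bP n t).
      rewrite EFinM; apply: (@le_trans _ _ (2%:E * (`|x|%:E * bavg n (fun t r => `|g r - g t|%R) t))%E).
        by apply: lee_wpmul2l => //; exact: (bavg_pairing _ sg g_2).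
      by rewrite muleA -EFinM; apply: lee_wpmul2r; [exact: bavg_ge0|rewrite lee_fin].
    apply: le_trans (leeD (bd _ _ _ sg1 g1_2 bP1) (bd _ _ _ sg2 g2_2 bP2)).
    rewrite -EFinD lee_fin -/q1 -/q2.
    have := ler_norm (q1 - g1 t x); have := ler_norm (- (q2 - g2 t x)).
    rewrite normrN; lra.
move: (aeI wu1 wu2); apply: aeS => t [wu1t wu2t] tI.
have := y_eq0 t; move: (tI); rewrite in_itv/= => tT /(_ tT).
move=> /eqP; rewrite sqrf_eq0 normr_eq0 subr_eq0 => /eqP.
by rewrite wu1t// wu2t// => /et_i_injective.
Unshelve. all: by end_near. Qed.
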